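(* Let $m,N\in\mathbb{N}$, $r>0$, $\alpha>0$, $\beta\ge0$, let $g:(0,\infty)\to(0,\infty)$ be a bounded and smooth function, and let $n\in\{1,\dots,N\}$. Assume that either - $r>(m-1)/2$ and $\int_1^\infty t^{\alpha-Nm/2-1}e^{-\beta t}g(t)\,dt<\infty$, or - $r=(m-1)/2$, $\alpha>N$, and $\int_1^\infty t^{\alpha-Nm/2-1}e^{-\beta t}g(t)\,dt<\infty$. Assume that $g$ is nonincreasing. Suppose further that $$\alpha+1\le n(m-5)/2 .$$ Then the estimator $\hat p^{(\alpha,\beta,g,(1-m)/2,j^{(m)}/2)}$ dominates the estimator $\hat p^{((1-m)/2,\,j^{(m)}/2)}$ (the Bayes estimator under the Jeffreys prior) under the loss $$\tilde L_n(\tilde d,p)=\sum_{\nu=1}^{n}\sum_{i=1}^{m}\Big(\tilde d_{i,\nu}-p_{i,\nu}-p_{i,\nu}\log\frac{\tilde d_{i,\nu}}{p_{i,\nu}}\Big),\qquad \tilde d\in(0,\infty)^{m\times N}.$$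
   Context: $\mathbb{N}=\{1,2,\dots\}$, $\mathbb{N}_0=\{0,1,2,\dots\}$; $j^{(m)}=(1,\dots,1)'\in\mathbb{R}^m$, $j^{(N)}=(1,\dots,1)'\in\mathbb{R}^N$, and $e_\nu^{(N)}$ is the $\nu$th standard unit vector of $\mathbb{R}^N$. Let $D_m=\{(q_1,\dots,q_m)'\,:\,q_1,\dots,q_m>0,\ \sum_{i=1}^m q_i<1\}$. For $r>0$ and $q\in D_m$, with $q_0=1-\sum_{i=1}^m q_i$, the negative multinomial distribution $\mathrm{NM}_m(r,q)$ has probability mass function $$\mathrm{NM}_m(x\mid r,q)=\frac{\Gamma(r+\sum_{i=1}^m x_i)}{\Gamma(r)\prod_{i=1}^m x_i!}\,q_0^{\,r}\prod_{i=1}^m q_i^{x_i},\qquad x\in\mathbb{N}_0^m .$$ The observations $X_\nu=(X_{1,\nu},\dots,X_{m,\nu})'$, $\nu=1,\dots,N$, are independent with $X_\nu\sim\mathrm{NM}_m(r,p_\nu)$, where $r$ is known and $p=(p_1,\dots,p_N)\in D_m^N$ is unknown. Put $X_{\cdot,\nu}=\sum_{i=1}^m X_{i,\nu}$ and $X_{\cdot}=(X_{\cdot,1},\dots,X_{\cdot,N})'$. For $\xi_0\ge0$ and $\xi\in[0,\infty)^N$ define $$K(\alpha,\beta,g,\xi_0,\xi)=\int_0^\infty t^{\alpha-1}e^{-\beta t}g(t)\Big\{\prod_{\nu=1}^N\frac{\Gamma(t+\xi_0)}{\Gamma(t+\xi_0+\xi_\nu)}\Big\}dt .$$ For $a_0\in\mathbb{R}$,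 $a=(a_1,\dots,a_m)'\in(0,\infty)^m$, $a_\cdot=\sum_{i=1}^m a_i$, define the $m\times N$ matrix-valued estimators with entries $$\hat p^{(a_0,a)}_{i,\nu}=\frac{X_{i,\nu}+a_i}{r+a_0+X_{\cdot,\nu}+a_\cdot},\qquad \hat p^{(\alpha,\beta,g,a_0,a)}_{i,\nu}=\frac{X_{i,\nu}+a_i}{r+a_0+X_{\cdot,\nu}+a_\cdot+\delta_\nu^{(\alpha,\beta,g,a_0,a)}(X_\cdot)},$$ where, for $z\in\mathbb{N}_0^N$, $$\delta_\nu^{(\alpha,\beta,g,a_0,a)}(z)=\frac{K(\alpha+1,\beta,g,r+a_0,z+a_\cdot j^{(N)}+e_\nu^{(N)})}{K(\alpha,\beta,g,r+a_0,z+a_\cdot j^{(N)}+e_\nu^{(N)})}.$$ In the claim these are used with $a_0=(1-m)/2$ and $a=j^{(m)}/2$, so $a_\cdot=m/2$. The risk of an estimator $\hat p$ under a loss $L$ is $E_p[L(\hat p,p)]$. An estimator $\hat p$ dominates $\hat p^*$ under $L$ if $E_p[L(\hat p,p)]\le E_p[L(\hat p^*,p)]$ for all $p\in D_m^N$, with strict inequality for at least one $p$. *)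

(* Defs.v *)
From HB Require Import structures.
From mathcomp Require Import all_boot all_order all_algebra.
From mathcomp Require Import all_classical all_reals all_analysis.

Set Implicit Arguments.
Unset Strict Implicit.
Unset Printing Implicit Defensive.

Import Order.TTheory GRing.Theory Num.Theory.
Import numFieldNormedType.Exports.

Local Open Scope classical_set_scope.
Local Open Scope ring_scope.

(* Only meaningful for [0 < x], the only case in which it is used. *)
Definition Gamma (R : realType) (x : R) : R :=
  \int[lebesgue_measure]_(t in `]0, +oo[) (t `^ (x - 1) * expR (- t)).

Definition smooth_on (R : realType) (A : set R) (g : R -> R) : Prop :=
  forall (k : nat) (t : R), A t -> derivable (derive1n k g) t 1.

(** The negative multinomial distribution *)

Definition Dset (R : realType) (m : nat) : set 'cV[R]_m :=
  [set q | (forall i, 0 < q i 0) /\ \sum_(i < m) q i 0 < 1].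

(* The set D_m^N; the parameter p_nu is the column nu of p. *)
Definition Dmx (R : realType) (m N : nat) : set 'M[R]_(m, N) :=
  [set p | forall nu, Dset (col nu p)].

Definition NM_pmf (R : realType) (m : nat) (r : R) (q : 'cV[R]_m)
    (x : 'cV[nat]_m) : R :=
  Gamma (r + (\sum_(i < m) x i ord0)%N%:R)
    / (Gamma r * \prod_(i < m) ((x i ord0)`!)%:R)
  * (1 - \sum_(i < m) q i 0) `^ r
  * \prod_(i < m) q i 0 ^+ x i ord0.

(* Under every [P p] with p in D_m^N, the columns X_nu of the random matrix X
   are independent and X_nu has distribution NM_m(r, p_nu).  The sample space
   of X_nu is countable and carries the discrete sigma-algebra, whence the
   arbitrary sets [B nu] in the independence condition; taking some of them to
   be [setT] gives the product rule for subfamilies. *)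
Definition NM_model (R : realType) (m N : nat) (r : R) (d : measure_display)
    (T : measurableType d) (P : 'M[R]_(m, N) -> probability T R)
    (X : T -> 'M[nat]_(m, N)) : Prop :=
  [/\ forall i nu, measurable_fun setT (fun w => X w i nu),
      forall p, Dmx p -> forall B : 'I_N -> set 'cV[nat]_m,
        P p [set w | forall nu, B nu (col nu (X w))]
        = (\prod_(nu < N) P p [set w | B nu (col nu (X w))])%E
    & forall p, Dmx p -> forall nu (x : 'cV[nat]_m),
        P p [set w | col nu (X w) = x] = (NM_pmf r (col nu p) x)%:E].

(** Estimators *)

Definition Xdot (m N : nat) (x : 'M[nat]_(m, N)) : 'cV[nat]_N :=
  \col_(nu < N) (\sum_(i < m) x i nu)%N.

(* [Rintegral] is 0 when the integral is +oo; the ratios of [K] below are used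
   only where the integrals are finite. *)
Definition K (R : realType) (N : nat) (alpha beta : R) (g : R -> R)
    (xi0 : R) (xi : 'cV[R]_N) : R :=
  \int[lebesgue_measure]_(t in `]0, +oo[)
    (t `^ (alpha - 1) * expR (- (beta * t)) * g t *
     \prod_(nu < N) (Gamma (t + xi0) / Gamma (t + xi0 + xi nu 0))).

Definition adot (R : realType) (m : nat) (a : 'cV[R]_m) : R :=
  \sum_(i < m) a i 0.

Definition delta (R : realType) (m N : nat) (r alpha beta : R) (g : R -> R)
    (a0 : R) (a : 'cV[R]_m) (nu : 'I_N) (z : 'cV[nat]_N) : R :=
  let xi : 'cV[R]_N :=
    map_mx (fun k => k%:R) z + const_mx (adot a) + delta_mx nu 0 in
  K (alpha + 1) beta g (r + a0) xi / K alpha beta g (r + a0) xi.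

Definition est0 (R : realType) (m N : nat) (r a0 : R) (a : 'cV[R]_m)
    (x : 'M[nat]_(m, N)) : 'M[R]_(m, N) :=
  \matrix_(i, nu) (((x i nu)%:R + a i 0)
                   / (r + a0 + (Xdot x nu 0)%:R + adot a)).

Definition est (R : realType) (m N : nat) (r alpha beta : R) (g : R -> R)
    (a0 : R) (a : 'cV[R]_m) (x : 'M[nat]_(m, N)) : 'M[R]_(m, N) :=
  \matrix_(i, nu) (((x i nu)%:R + a i 0)
                   / (r + a0 + (Xdot x nu 0)%:R + adot a
                      + delta r alpha beta g a0 a nu (Xdot x))).

(** Loss, risk and domination *)

(* Columns are numbered from 0, so [nu < n] selects the first n of them. *)
Definition Ltilde (R : realType) (m N : nat) (n : nat)
    (e p : 'M[R]_(m, N)) : R :=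
  \sum_(nu < N | (nu < n)%N) \sum_(i < m)
    (e i nu - p i nu - p i nu * ln (e i nu / p i nu)).

Definition risk (R : realType) (m N : nat) (d : measure_display)
    (T : measurableType d) (P : 'M[R]_(m, N) -> probability T R)
    (X : T -> 'M[nat]_(m, N)) (L : 'M[R]_(m, N) -> 'M[R]_(m, N) -> R)
    (phat : 'M[nat]_(m, N) -> 'M[R]_(m, N)) (p : 'M[R]_(m, N)) : \bar R :=
  ('E_(P p) [fun w => L (phat (X w)) p])%E.

Definition dominates (R : realType) (m N : nat) (d : measure_display)
    (T : measurableType d) (P : 'M[R]_(m, N) -> probability T R)
    (X : T -> 'M[nat]_(m, N)) (L : 'M[R]_(m, N) -> 'M[R]_(m, N) -> R)
    (phat phat' : 'M[nat]_(m, N) -> 'M[R]_(m, N)) : Prop :=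
  (forall p, Dmx p -> (risk P X L phat p <= risk P X L phat' p)%E) /\
  (exists2 p, Dmx p & (risk P X L phat p < risk P X L phat' p)%E).

(* Main.v *)
Require Import Defs.
From HB Require Import structures.
From mathcomp Require Import all_boot all_order all_algebra.
From mathcomp Require Import all_classical all_reals all_analysis.
From mathcomp Require Import measurable_realfun real_interval.
From mathcomp Require Import ring lra.

Set Implicit Arguments.
Unset Strict Implicit.
Unset Printing Implicit Defensive.

Import Order.TTheory GRing.Theory Num.Theory.
Import numFieldNormedType.Exports.

Local Open Scope classical_set_scope.
Local Open Scope ring_scope.

(** Let rho = r + (1 - m)/2 >= 0 and c_nu(z) = r + 1/2 + z_nu, and let f_z be the
    integrand of K at xi = z + a_. j. The ratio delta_nu(z) is a quotient of
    integrals of t f_z / (t + c_nu) and f_z / (t + c_nu), whereas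
    delta_nu(z - e_nu) is the mean of t under f_z and does not depend on nu.
    Multiplying the negative multinomial mass function by p_{i,nu} shifts
    x_{i,nu} by one, so the risk difference is the expectation of a function of
    X_. alone, and it suffices to bound that function pointwise. With
    ln (1 + u) <= u the pointwise bound reduces, by Chebyshev's sum inequality
    in nu, to

      sum_nu (z_nu + m/2) int t^2 f_z / (t + c_nu) <= (alpha + 1) int t f_z,

    which is what integration by parts gives, g being nonincreasing. It is
    obtained here by comparing f_z with its dilations, so that neither g nor
    Gamma has to be differentiated. The decay of Gamma(x) / Gamma(x + k/2) in x
    that it needs follows from the functional equation and from log-convexity
    of Gamma at midpoints; the functional equation comes from dilations too.
    The integrals converge at infinity because alpha + 1 <= n (m - 5)/2. *)

(** * Integrals over the positive half-line *)

(** What shrinking removes from the loss carries the weight [1 / c_nu ^ 2], whereas integration by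
    parts bounds an unweighted sum over nu. With [D] the mean of [t], [b_nu = z_nu + m / 2] and
    [W_nu] the integral of [t^2 f_z / (t + c_nu)] over that of [f_z], both the weight and the slack
    [(m - 5) / 2 * D - b_nu * W_nu] decrease in [z_nu]; this is what Chebyshev's inequality
    exploits. The 5 is twice [3/2 + 1]: after the shift the logarithmic part has the denominators
    [c_nu - 3/2] and [c_nu - 1], and replacing their product by [c_nu ^ 2] costs 5/2 in the
    numerator.

    Risks may be infinite, so their difference is never formed. The identities are kept additive,
    between sums of nonnegative terms in the extended reals, and only the expectation of the removed
    term, which is at most N, is cancelled. Strictness also needs a finite risk at one p. This p is
    so small that [2 p] is still a parameter: the loss grows more slowly than [2 ^ |x|], and that
    factor tilts the law at p into a multiple of the law at [2 p]. The strict gap itself comes from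
    the observation 0, where the logarithmic part vanishes. *)

Section HalfLine.
Variable R : realType.
Local Notation mu := (@lebesgue_measure R).
Local Notation Ry := (`]0%R, +oo[%classic : set R).

(** By uniqueness of Lebesgue measure it is enough to compare half-open intervals. *)
Lemma lebesgue_measure_scale (k : R) (A : set R) : 0 < k -> measurable A ->
  (k%:E * pushforward mu (fun t : R => (k * t)%R : measurableTypeR R) A = mu A)%E.
Proof.
move=> k0 mA.
have mk : measurable_fun setT (fun t : R => k * t : measurableTypeR R).
  exact: measurable_funM.
pose k' : {nonneg R} := NngNum (ltW k0).
pose nu : {measure set (measurableTypeR R) -> \bar R} :=
  mscale k' (pushforward mu (fun t : R => (k * t)%R : measurableTypeR R)).
apply/esym; rewrite (@lebesgue_measure_unique R (nu mk)) => // X [[a b]] _ <-.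
rewrite /nu /= /mscale /= /pushforward.
have -> : (fun t : R => k * t) @^-1` `]a, b] = `](a / k), (b / k)]%classic.
  by apply/seteqP; split=> t /=; rewrite !in_itv /= ltr_pdivrMr // ler_pdivlMr // ![t * k]mulrC.
rewrite !lebesgue_measure_itv /= !lte_fin ltr_pM2r ?invr_gt0 //.
case: ifP => _; last by rewrite mule0.
by rewrite -!EFinD -EFinM mulrBr ![k * (_ / _)]mulrC !mulfVK ?gt_eqF.
Qed.

Lemma ge0_integral_scale (k : R) (f : R -> \bar R) : 0 < k ->
  measurable_fun Ry f -> (forall t, 0 < t -> (0 <= f t)%E) ->
  (\int[mu]_(t in Ry) f t = k%:E * \int[mu]_(t in Ry) f (k * t)%R)%E.
Proof.
move=> k0 mf f0.
have mk : measurable_fun setT (fun t : R => k * t : measurableTypeR R).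
  exact: measurable_funM.
have -> : (\int[mu]_(t in Ry) f (k * t)%R =
    \int[pushforward mu (fun t : R => (k * t)%R : measurableTypeR R)]_(t in Ry) f t)%E.
  rewrite ge0_integral_pushforward //; last first.
    by move=> y; rewrite inE /= in_itv /= andbT => /f0.
  congr integral; apply/seteqP; split=> t /=; rewrite !in_itv /= !andbT.
    by move=> t0; rewrite mulr_gt0.
  by rewrite pmulr_rgt0.
pose k' : {nonneg R} := NngNum (ltW k0).
rewrite -(@ge0_integral_mscale _ _ _ _ _ _ k') //; last first.
  by move=> y /=; rewrite in_itv /= andbT => /f0.
apply: eq_measure_integral => A mA _.
by rewrite /= /mscale /= lebesgue_measure_scale.
Qed.

Lemma integral_powR (p a b : R) : p != 0 -> 0 < a -> a < b ->
  (\int[mu]_(t in `[a, b]) (t `^ (p - 1))%:E = (b `^ p / p - a `^ p / p)%:E)%E.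
Proof.
move=> p0 a0 ab.
have dP q x : 0 < x -> derivable (fun t : R => t `^ q) x 1.
  move=> x0; have /(_ x) := @derivable_powR R 1 q.
  by rewrite in_itv /= x0; apply.
have dF x : 0 < x -> derivable (fun t : R => t `^ p / p) x 1.
  by move=> x0; apply: derivableM => //; exact: dP.
have cF x : 0 < x -> {for x, continuous (fun t : R => t `^ p / p)}.
  by move=> x0; apply: differentiable_continuous; apply/derivable1_diffP; exact: dF.
rewrite (@continuous_FTC2 _ _ (fun t => t `^ p / p)) ?EFinB //.
- apply: derivable_within_continuous => x; rewrite in_itv /= => /andP[ax _].
  by apply: dP; apply: lt_le_trans ax.
- split.
  + move=> x; rewrite in_itv /= => /andP[ax _].
    by apply: dF; apply: lt_trans ax.
  + apply: cvg_at_right_filter; exact: cF.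
  + apply: cvg_at_left_filter; apply: cF; exact: lt_trans ab.
- move=> x; rewrite in_itv /= => /andP[ax _].
  have x0 : 0 < x by apply: lt_trans ax.
  rewrite derive1Mr; last exact: dP.
  by rewrite powR_derive1 ?in_itv /= ?x0 // mulrAC mulfV // mul1r.
Qed.

(** Monotone convergence, in the form that carries the compact-interval values of [integral_powR]
    over to the unbounded or open ranges. *)
Lemma ge0_integral_bigcup_le (F : nat -> set R) (f : R -> \bar R) (M : \bar R) :
  {homo F : n m / (n <= m)%N >-> (n <= m)%O} -> (forall i, measurable (F i)) ->
  (forall i, measurable_fun (F i) f) -> (forall i x, F i x -> (0 <= f x)%E) ->
  (forall i, (\int[mu]_(x in F i) f x <= M)%E) ->
  (\int[mu]_(x in \bigcup_i F i) f x <= M)%E.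
Proof.
move=> hF mF mf f0 le.
have H := @ge0_nondecreasing_set_cvg_integral _ (measurableTypeR R) R F f
  (@lebesgue_measure R) hF mF mf f0.
rewrite -(cvg_lim _ H) //; apply: lime_le; first by apply/cvg_ex; eexists; exact: H.
by apply: nearW.
Qed.

Lemma integral_powR_near0 (p : R) : 0 < p ->
  (\int[mu]_(t in `]0%R, 1%R]) (t `^ (p - 1))%:E < +oo)%E.
Proof.
move=> p0; apply: (@le_lt_trans _ _ (p^-1)%:E); last exact: ltry.
rewrite itv_open_bnd_bigcup; apply: ge0_integral_bigcup_le => //.
- move=> n k nk; apply/subsetPset => x /=; rewrite !in_itv /= !add0r.
  case/andP => h ->; rewrite andbT; apply: le_trans h.
  by rewrite lef_pV2 ?posrE ?ltr0n // ler_nat.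
- by move=> i; apply/measurable_EFinP; apply: measurable_funTS; exact: measurable_powR.
- by move=> i x _; rewrite lee_fin powR_ge0.
(* The interval of index 0 is the single point 1, which the strict [a < b] of [integral_powR]
   excludes. *)
- move=> [|n]; rewrite add0r.
    rewrite invr1 set_itv1 integral_set1 lee_fin invr_ge0 ltW //.
  rewrite integral_powR ?gt_eqF ?invr_gt0 ?ltr0n //; last first.
    by rewrite invf_lt1 ?ltr1n ?ltr0n.
  by rewrite lee_fin powR1 mul1r lerBlDr lerDl divr_ge0 ?powR_ge0 // ltW.
Qed.

Lemma integral_powR_nearoo :
  (\int[mu]_(t in `[1%R, +oo[) (t `^ (- 2))%:E < +oo)%E.
Proof.
apply: (@le_lt_trans _ _ 1%:E); last exact: ltry.
rewrite (itv_bndy_bigcup_BRight true (1 : R)); apply: ge0_integral_bigcup_le => //.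
- move=> n k nk; apply/subsetPset => x /=; rewrite !in_itv /=.
  case/andP => -> h /=; apply: le_trans h _.
  by rewrite lerD2l ler_nat.
- by move=> i; apply/measurable_EFinP; apply: measurable_funTS; exact: measurable_powR.
- by move=> i x _; rewrite lee_fin powR_ge0.
- move=> [|n].
    by rewrite addr0 set_itv1 integral_set1 lee_fin.
  have -> : (- 2 : R) = (-1) - 1 by lra.
  rewrite integral_powR ?oppr_eq0 ?oner_eq0 //; last by rewrite ltrDl ltr0n.
  rewrite lee_fin powR1 invrN1 !mulrN1 opprK.
  by rewrite addrC lerBlDr lerDl powR_ge0.
Qed.

(** Comparison with a power at each end. The exponent -2 at infinity is fixed because it suits both
    the Gamma integrand and [t * f t] for the kernel [f]. *)
Lemma integrable_Ry (f : R -> R) (p C : R) : 0 < p -> 0 <= C ->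
  measurable_fun Ry f ->
  (forall t, 0 < t -> t <= 1 -> `|f t| <= C * t `^ (p - 1)) ->
  (forall t, 1 <= t -> `|f t| <= C * t `^ (- 2)) ->
  mu.-integrable Ry (EFin \o f).
Proof.
move=> p0 C0 mf h0 h1; apply/integrableP; split; first exact/measurable_EFinP.
have UE : Ry = `]0, 1] `|` `]1, +oo[ :> set R.
  apply/seteqP; split=> x /=; rewrite !in_itv /= !andbT.
    by move=> ->; case: (leP x 1); [left|right].
  by case=> [/andP[]//|]; apply: lt_trans.
have mA : measurable_fun Ry (fun x => `|(EFin \o f) x|%E).
  by apply: measurableT_comp => //; exact/measurable_EFinP.
rewrite UE ge0_integral_setU //; last 2 first.
- by rewrite -UE.
- rewrite disj_set2E; apply/eqP; rewrite -subset0 => x /=.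
  by rewrite !in_itv /= andbT => -[/andP[_ x1]]; rewrite ltNge x1.
have mS (S : set R) q : measurable_fun S (fun t : R => (C%:E * (t `^ q)%:E)%E).
  apply: measurable_funeM; apply/measurable_EFinP; apply: measurable_funTS; exact: measurable_powR.
have sub1 : `]0, 1] `<=` Ry by rewrite UE; left.
have sub2 : `]1, +oo[ `<=` Ry by rewrite UE; right.
apply: lte_add_pinfty.
  apply: (@le_lt_trans _ _ (\int[mu]_(t in `]0%R, 1%R]) (C%:E * (t `^ (p - 1))%:E))%E).
    apply: ge0_le_integral => //.
    - exact: measurable_funS mA.
    - exact: mS.
    - by move=> x; rewrite /= in_itv /= => /andP[x0 x1]; rewrite lee_fin h0.
  rewrite ge0_integralZl_EFin //.
  - by apply: lte_mul_pinfty => //; exact: integral_powR_near0.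
  - by move=> x _; rewrite lee_fin powR_ge0.
  - by apply/measurable_EFinP; apply: measurable_funTS; exact: measurable_powR.
apply: (@le_lt_trans _ _ (\int[mu]_(t in `]1%R, +oo[) (C%:E * (t `^ (- 2))%:E))%E).
  apply: ge0_le_integral => //.
  - exact: measurable_funS mA.
  - exact: mS.
  - by move=> x; rewrite /= in_itv /= andbT => x1; rewrite lee_fin h1 // ltW.
rewrite ge0_integralZl_EFin //.
- apply: lte_mul_pinfty => //; apply: le_lt_trans integral_powR_nearoo.
  apply: ge0_subset_integral => //.
  + by apply/measurable_EFinP; apply: measurable_funTS; exact: measurable_powR.
  + by move=> x _; rewrite lee_fin powR_ge0.
  + by move=> x /=; rewrite !in_itv /= !andbT; apply: ltW.
- by move=> x _; rewrite lee_fin powR_ge0.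
- by apply/measurable_EFinP; apply: measurable_funTS; exact: measurable_powR.
Qed.

Lemma eq_integral_Ry (f g : R -> \bar R) : (forall t, 0 < t -> f t = g t) ->
  (\int[mu]_(t in Ry) f t = \int[mu]_(t in Ry) g t)%E.
Proof.
by move=> fg; apply: eq_integral => t; rewrite inE /= in_itv /= andbT => /fg.
Qed.

Lemma integrable_RyZl (k : R) (f : R -> R) : mu.-integrable Ry (EFin \o f) ->
  mu.-integrable Ry (EFin \o (fun t => k * f t)).
Proof.
move=> fi; apply: (@eq_integrable _ _ _ mu Ry _ (fun t => k%:E * (EFin \o f) t)%E) => //.
exact: integrableZl.
Qed.

Lemma integrable_RyD (f g : R -> R) : mu.-integrable Ry (EFin \o f) ->
  mu.-integrable Ry (EFin \o g) -> mu.-integrable Ry (EFin \o (fun t => f t + g t)).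
Proof.
move=> fi gi; apply: (@eq_integrable _ _ _ mu Ry _ ((EFin \o f) \+ (EFin \o g))%E) => //.
exact: integrableD.
Qed.

Lemma integrable_RyB (f g : R -> R) : mu.-integrable Ry (EFin \o f) ->
  mu.-integrable Ry (EFin \o g) -> mu.-integrable Ry (EFin \o (fun t => f t - g t)).
Proof.
move=> fi gi; apply: (@eq_integrable _ _ _ mu Ry _ ((EFin \o f) \- (EFin \o g))%E) => //.
exact: integrableB.
Qed.

Lemma le_Rintegral_Ry (f g : R -> R) : mu.-integrable Ry (EFin \o f) ->
  mu.-integrable Ry (EFin \o g) -> (forall t, 0 < t -> f t <= g t) ->
  \int[mu]_(t in Ry) f t <= \int[mu]_(t in Ry) g t.
Proof.
move=> fi gi fg; apply: le_Rintegral => // t.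
by rewrite /= in_itv /= andbT => /fg.
Qed.

(** Superlevel sets of a monotone function are intervals. The kernel is a power times a
    nonincreasing factor, so this is the source of its measurability. *)
Lemma nonincreasing_measurable_Ry (f : R -> R) :
  (forall s t, 0 < s -> s <= t -> f t <= f s) -> measurable_fun Ry f.
Proof.
move=> fd; apply: (measurability (@RGenCInfty.G R)) => [|/= _ [_] [r] -> <-].
  exact: RGenCInfty.measurableE.
apply: is_interval_measurable => s t /=.
rewrite !in_itv /= !andbT => -[s0 fs] [t0 ft] u /andP[su ut].
have u0 : 0 < u by apply: lt_le_trans su.
by rewrite !in_itv /= !andbT; split=> //; apply: le_trans (fd _ _ u0 ut).
Qed.

End HalfLine.

(** * The Gamma function *)

Section GammaFunction.
Variable R : realType.
Local Notation mu := (@lebesgue_measure R).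
Local Notation Ry := (`]0%R, +oo[%classic : set R).
Implicit Types x y t : R.

(** A zero integral would make [f] vanish almost everywhere, so the half-line itself would be a null
    set. *)
Lemma Rintegral_Ry_gt0 (f : R -> R) : mu.-integrable Ry (EFin \o f) ->
  (forall t, 0 < t -> 0 < f t) -> 0 < \int[mu]_(t in Ry) f t.
Proof.
move=> fi f0; rewrite lt_neqAle Rintegral_ge0 ?andbT; last first.
  by move=> t; rewrite /= in_itv /= andbT => /f0 /ltW.
apply/eqP => I0.
have mf := measurable_int _ fi.
have Ie : (\int[mu]_(t in Ry) `|(EFin \o f) t| = 0)%E.
  have -> : (\int[mu]_(t in Ry) `|(EFin \o f) t| = \int[mu]_(t in Ry) (EFin \o f) t)%E.
    apply: eq_integral_Ry => t t0 /=.
    by rewrite gtr0_norm // f0.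
  have fin : (\int[mu]_(t in Ry) (EFin \o f) t)%E \is a fin_num by exact: integrable_fin_num.
  by rewrite -(fineK fin); have -> : fine (\int[mu]_(t in Ry) (EFin \o f) t)%E = 0 := esym I0.
move/(ae_eq_integral_abs mu (measurable_itv _) mf): Ie => [A [mA A0 sA]].
have sR : Ry `<=` A.
  move=> t tR; apply: sA => /(_ tR) [] ft.
  by move: tR; rewrite /= in_itv /= andbT => /f0; rewrite ft ltxx.
have : (mu Ry <= mu A)%E by apply: le_measure; rewrite ?inE.
by rewrite [X in (_ <= X)%E]A0 lebesgue_measure_itv /= ltry.
Qed.

Lemma measurable_Gamma_integrand x :
  measurable_fun Ry (fun t : R => t `^ (x - 1) * expR (- t)).
Proof.
apply: measurable_funM; first by apply: measurable_funTS; exact: measurable_powR.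
by apply: measurableT_comp => //; exact: measurable_funN.
Qed.

Lemma integrable_Gamma x : 0 < x ->
  mu.-integrable Ry (EFin \o (fun t : R => t `^ (x - 1) * expR (- t))).
Proof.
move=> x0; have [n xn] : exists n : nat, x + 1 <= n.+1%:R.
  exists (Num.truncn (x + 1)); apply: ltW; apply: truncnS_gt.
(* The constant comes from one term of the exponential series: for [t >= 1],
   [t ^ (x + 1) <= t ^ n.+1], which is at most the factorial of [n.+1] times [expR t]. *)
apply: (@integrable_Ry R _ x (n.+1)`!%:R) => //; first exact: measurable_Gamma_integrand.
- move=> t t0 t1; rewrite ger0_norm ?mulr_ge0 ?powR_ge0 ?expR_ge0 // mulrC.
  rewrite ler_wpM2r ?powR_ge0 //; apply: (@le_trans _ _ 1).
    by rewrite expR_le1 oppr_le0 ltW.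
  by rewrite ler1n fact_gt0.
- move=> t t1; have t0 : 0 < t by apply: lt_le_trans t1.
  rewrite ger0_norm ?mulr_ge0 ?powR_ge0 ?expR_ge0 //.
  have -> : x - 1 = (x + 1) + (- 2) by lra.
  rewrite powRD ?(gt_eqF t0) ?implybT // mulrAC ler_wpM2r ?powR_ge0 //.
  rewrite expRN ler_pdivrMr ?expR_gt0 //.
  apply: (@le_trans _ _ (t ^+ n.+1)).
    by rewrite -(powR_mulrn _ (ltW t0)); apply: ler_powR.
  rewrite -ler_pdivrMl ?ltr0n ?fact_gt0 // mulrC.
  by apply: le_trans (expR_ge1Dxn n (ltW t0)); rewrite lerDr.
Qed.

Lemma Gamma_gt0 x : 0 < x -> 0 < Gamma x.
Proof.
move=> x0; apply: Rintegral_Ry_gt0; first exact: integrable_Gamma.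
by move=> t t0; rewrite mulr_gt0 ?powR_gt0 ?expR_gt0.
Qed.

Lemma Gamma_scale x (k : R) : 0 < x -> 0 < k ->
  mu.-integrable Ry (EFin \o (fun t : R => t `^ (x - 1) * expR (- (k * t)))) /\
  \int[mu]_(t in Ry) (t `^ (x - 1) * expR (- (k * t))) = k `^ (- x) * Gamma x.
Proof.
move=> x0 k0; pose f t := t `^ (x - 1) * expR (- t).
have fi := integrable_Gamma x0.
have E t : 0 < t -> t `^ (x - 1) * expR (- (k * t)) = k `^ (- (x - 1)) * f (k * t).
  move=> t0; rewrite /f powRM ?(ltW k0) ?(ltW t0) // !mulrA -powRD ?(gt_eqF k0) ?implybT //.
  by rewrite addNr powRr0 mul1r.
have f0 t : 0 <= f t by rewrite mulr_ge0 ?powR_ge0 ?expR_ge0.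
have mf : measurable_fun Ry (EFin \o f) by exact: measurable_int fi.
have Ik : (\int[mu]_(t in Ry) (f (k * t))%:E = (k^-1 * Gamma x)%:E)%E.
  have := ge0_integral_scale k0 mf (fun t _ => f0 t).
  have fin : (\int[mu]_(t in Ry) (f t)%:E)%E \is a fin_num by exact: (integrable_fin_num _ fi).
  have -> : (k^-1 * Gamma x)%:E = (k^-1%:E * \int[mu]_(t in Ry) (f t)%:E)%E.
    by rewrite -(fineK fin) -EFinM.
  by move=> ->; rewrite muleA -EFinM mulVf ?gt_eqF // mul1e.
have mg : measurable_fun Ry (fun t : R => t `^ (x - 1) * expR (- (k * t))).
  apply: measurable_funM; first by apply: measurable_funTS; exact: measurable_powR.
  apply: measurableT_comp => //; apply: measurable_funN; exact: measurable_funM.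
have mfk : measurable_fun Ry (fun t : R => (f (k * t))%:E).
  apply/measurable_EFinP; apply: (@measurable_comp _ _ _ _ _ _ Ry f Ry (fun t : R => k * t)) => //.
  - by move=> _ [s] sR <-; move: sR; rewrite /= !in_itv /= !andbT; apply: mulr_gt0.
  - exact/measurable_EFinP.
  - exact: measurable_funM.
have Ig : (\int[mu]_(t in Ry) (t `^ (x - 1) * expR (- (k * t)))%:E =
     (k `^ (- x) * Gamma x)%:E)%E.
  rewrite (@eq_integral_Ry _ _ (fun t => (k `^ (- (x - 1)))%:E * (f (k * t))%:E)%E); last first.
    by move=> t t0; rewrite E // EFinM.
  rewrite ge0_integralZl_EFin ?powR_ge0 //; last by move=> t _; rewrite lee_fin.
  rewrite Ik -EFinM mulrA; congr (_ * _)%:E.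
  by rewrite -powR_inv1 ?ltW // -powRD ?(gt_eqF k0) ?implybT //; congr (_ `^ _); lra.
split; last by rewrite /Rintegral Ig.
apply/integrableP; split; first exact/measurable_EFinP.
rewrite (@eq_integral_Ry _ _ (fun t => (t `^ (x - 1) * expR (- (k * t)))%:E)); last first.
  by move=> t t0; rewrite /= ger0_norm // mulr_ge0 ?powR_ge0 ?expR_ge0.
by rewrite Ig ltry.
Qed.

(** The expression vanishes at [u = 0], so it is minimal there, and its derivative there is [q - x].
    A second-order bound on [expR] replaces the derivative. *)
Lemma tangent_eq (x q : R) : 0 < x ->
  (forall u : R, 0 <= expR (- (x * u)) - 1 + (expR u - 1) * q) -> 0 <= q -> q = x.
Proof.
move=> x0 H q0.
(* From [expR v <= 1 / (1 - v)] and [(1 - v) * (1 + v + 2 v^2) = 1 + v^2 * (1 - 2 v)]. *)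
have ub (v : R) : v <= 2^-1 -> expR v <= 1 + v + 2 * v ^+ 2.
  move=> v1; have : 1 - v <= expR (- v) by apply: expR_ge1Dx.
  rewrite expRN => h; rewrite -[leLHS]invrK.
  have v0 : 0 < 1 - v by lra.
  apply: (@le_trans _ _ (1 - v)^-1).
    by rewrite lef_pV2 ?posrE // (lt_le_trans v0).
  by rewrite -[leLHS]div1r ler_pdivrMr //; nra.
have K (u : R) : `|u| <= 2^-1 -> `|x * u| <= 2^-1 ->
    0 <= (q - x) * u + 2 * (x ^+ 2 + q) * u ^+ 2.
  rewrite !ler_norml => /andP[_ u2] /andP[xu1 _].
  have h1 := ub u u2.
  have h2 : expR (- (x * u)) <= 1 - x * u + 2 * (x * u) ^+ 2.
    by rewrite -(sqrrN (x * u)); apply: ub; lra.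
  have := H u; have : (expR u - 1) * q <= (u + 2 * u ^+ 2) * q.
    by rewrite ler_wpM2r //; lra.
  move: h2; rewrite exprMn; nra.
pose C := 2 * (x ^+ 2 + q).
have C0 : 0 < C by rewrite mulr_gt0 // ltr_wpDr // exprn_gt0.
(* This radius keeps both [|u|] and [|x * u|] below 1/2, as [K] requires. *)
pose r0 : R := 2^-1 / (1 + x).
have r00 : 0 < r0 by rewrite divr_gt0 // ltr_wpDr // ltW.
have r01 : r0 * (1 + x) = 2^-1 by rewrite mulfVK // gt_eqF // ltr_wpDr // ltW.
(* Taking [u = e] and [u = - e] in [K] bounds [q - x] by [C * e] from both sides. *)
have small (w : R) : 0 < w -> `|q - x| <= w.
  move=> w0; pose e := Num.min r0 (w / C).
  have e0 : 0 < e by rewrite lt_min r00 divr_gt0.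
  have er : e <= r0 by rewrite ge_min lexx.
  have ew : C * e <= w by rewrite mulrC -ler_pdivlMr // ge_min lexx orbT.
  have e1 : e <= 2^-1 by nra.
  have e2 : x * e <= 2^-1 by nra.
  have [kp km] : 0 <= (q - x) * e + C * e ^+ 2 /\ 0 <= (q - x) * (- e) + C * e ^+ 2.
    split; first by apply: K; rewrite gtr0_norm // mulr_gt0.
    by rewrite -(sqrrN e); apply: K; rewrite ?mulrN normrN gtr0_norm // mulr_gt0.
  apply: le_trans ew; rewrite ler_norml; apply/andP; split.
    by rewrite -(ler_pM2r e0); nra.
  by rewrite -(ler_pM2r e0); nra.
apply/eqP; rewrite -subr_eq0 -normr_le0; apply/ler_addgt0Pr => w w0.
by rewrite add0r small.
Qed.

Let powR_split t (p q s : R) : 0 < t -> p = q + s -> t `^ p = t `^ q * t `^ s.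
Proof. by move=> t0 ->; rewrite powRD // (gt_eqF t0) implybT. Qed.

(* As a function of k, the right-hand side is a dilated Gamma integral and the
   left-hand side its tangent at k = 1. *)
Lemma Gamma_tangent x (k : R) : 0 < x -> 0 < k ->
  Gamma x - (k - 1) * Gamma (x + 1) <= k `^ (- x) * Gamma x.
Proof.
move=> x0 k0; have x1 : 0 < x + 1 by rewrite addr_gt0.
have [gi <-] := Gamma_scale x0 k0.
have fi := integrable_Gamma x0; have f1i := integrable_Gamma x1.
rewrite /Gamma -RintegralZl // -RintegralB //; last exact: integrable_RyZl.
apply: le_Rintegral_Ry => //.
  by apply: integrable_RyB => //; exact: integrable_RyZl.
move=> t t0; rewrite (@powR_split t (x + 1 - 1) 1 (x - 1)) ?powRr1 ?(ltW t0) //; last by ring.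
have -> : expR (- (k * t)) = expR (- t) * expR (- ((k - 1) * t)).
  by rewrite -expRD; congr expR; ring.
rewrite mulrA -subr_ge0 [X in 0 <= X](_ : _ =
  t `^ (x - 1) * expR (- t) * (expR (- ((k - 1) * t)) - (1 - (k - 1) * t))); last by ring.
by rewrite !mulr_ge0 ?powR_ge0 ?expR_ge0 // subr_ge0; apply: expR_ge1Dx.
Qed.

(** With [k = expR u] and [q = Gamma (x + 1) / Gamma x], [Gamma_tangent] divided by [Gamma x] is the
    hypothesis of [tangent_eq]. *)
Lemma GammaS x : 0 < x -> Gamma (x + 1) = x * Gamma x.
Proof.
move=> x0; have := Gamma_gt0 x0; have := Gamma_gt0 (addr_gt0 x0 ltr01).
have := fun k => @Gamma_tangent x k x0.
move: (Gamma (x + 1)) (Gamma x) => b c tangent b0 c0.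
suff qE : b / c = x by rewrite -{1}qE mulfVK // gt_eqF.
apply: (tangent_eq x0) => [u|]; last by rewrite divr_ge0 ?(ltW b0) ?(ltW c0).
have -> : expR (- (x * u)) = expR u `^ (- x) by rewrite -expRM mulrN mulrC.
have := tangent _ (expR_gt0 u); move: (expR u `^ (- x)) => v; move: (expR u) => k h.
rewrite -(pmulr_lge0 _ c0) mulrDl mulrBl mul1r -mulrA mulfVK ?gt_eqF //.
by lra.
Qed.

(** Under the integral, right side minus left side is a nonnegative factor times [(l - b) ^ 2 / l],
    where [b] is the square root of [t]. *)
Lemma Gamma_weighted_midpoint x (l : R) : 0 < x -> 0 < l ->
  2 * Gamma (x + 2^-1) <= l * Gamma x + l^-1 * Gamma (x + 1).
Proof.
move=> x0 l0; have x1 : 0 < x + 1 by rewrite addr_gt0.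
have xh : 0 < x + 2^-1 by rewrite addr_gt0.
have fi := integrable_Gamma x0; have f1i := integrable_Gamma x1.
have fh := integrable_Gamma xh.
rewrite /Gamma -!RintegralZl // -RintegralD //; try exact: integrable_RyZl.
apply: le_Rintegral_Ry; first exact: integrable_RyZl.
  by apply: integrable_RyD => //; exact: integrable_RyZl.
move=> t t0; set a := t `^ (x - 1); set b := t `^ 2^-1.
have h2 : (1 : R) = 2^-1 + 2^-1 by field.
have bb : b * b = t by rewrite -(powR_split t0 h2) powRr1 // ltW.
have -> : t `^ (x + 1 - 1) = a * (b * b).
  by rewrite bb (@powR_split t (x + 1 - 1) (x - 1) 1) ?powRr1 ?(ltW t0) //; ring.
rewrite (@powR_split t (x + 2^-1 - 1) (x - 1) 2^-1) //; last by ring.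
rewrite -/a -/b -subr_ge0.
rewrite [X in 0 <= X](_ : _ = a * expR (- t) * (l^-1 * (l - b) ^+ 2)).
  apply: mulr_ge0; first by rewrite mulr_ge0 ?powR_ge0 ?expR_ge0.
  by apply: mulr_ge0; rewrite ?sqr_ge0 // invr_ge0 ltW.
by field; rewrite gt_eqF.
Qed.

Lemma Gamma_midpoint x : 0 < x ->
  Gamma (x + 2^-1) ^+ 2 <= Gamma x * Gamma (x + 1).
Proof.
move=> x0; have := Gamma_gt0 x0.
have xh : 0 < x + 2^-1 by rewrite addr_gt0.
have := Gamma_gt0 xh; have := fun l => @Gamma_weighted_midpoint x l x0.
move: (Gamma x) (Gamma (x + 2^-1)) (Gamma (x + 1)) => c b a mid b0 c0.
(* The weight [l = b / c] turns the term [l * c] into [b] itself, so no square root is needed. *)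
have := mid _ (divr_gt0 b0 c0); rewrite mulfVK ?gt_eqF // invf_div => h.
have : b * b <= c / b * a * b by rewrite ler_pM2r //; lra.
by rewrite mulrAC mulfVK ?gt_eqF.
Qed.

End GammaFunction.

(* Abstracting from Gamma keeps unification from unfolding its integral. *)
Definition gamma_like (R : realType) (G : R -> R) : Prop :=
  [/\ forall x, 0 < x -> 0 < G x, forall x, 0 < x -> G (x + 1) = x * G x
    & forall x, 0 < x -> G (x + 2^-1) ^+ 2 <= G x * G (x + 1)].

Lemma gamma_like_Gamma (R : realType) : gamma_like (@Gamma R).
Proof. by split; [exact: Gamma_gt0|exact: GammaS|exact: Gamma_midpoint]. Qed.

(** * Quotients of Gamma at half-integer distance *)

Section GammaQuotient.
Variable R : realType.
Implicit Types x y t : R.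
Variable G : R -> R.
Hypothesis G_gamma : gamma_like G.

Let G_gt0 x : 0 < x -> 0 < G x. Proof. by case: G_gamma => + _ _; apply. Qed.
Let GS x : 0 < x -> G (x + 1) = x * G x. Proof. by case: G_gamma => _ + _; apply. Qed.
Let G_midpoint x : 0 < x -> G (x + 2^-1) ^+ 2 <= G x * G (x + 1).
Proof. by case: G_gamma => _ _; apply. Qed.

(** [k] counts half-steps: with [a_. = m / 2] the arguments of [K] are
    [z_nu + m / 2 = (2 z_nu + m) / 2], so each Gamma quotient factors into quotients over a step of
    1/2. *)
Definition gamma_quo (k : nat) x := G x / G (x + k%:R / 2).

Lemma gamma_quo_gt0 k x : 0 < x -> 0 < gamma_quo k x.
Proof.
by move=> x0; rewrite divr_gt0 // G_gt0 // ltr_wpDr // divr_ge0.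
Qed.

Lemma gamma_quo0 x : 0 < x -> gamma_quo 0 x = 1.
Proof. by move=> x0; rewrite /gamma_quo mul0r addr0 divff // gt_eqF // G_gt0. Qed.

Lemma gamma_quoD k l x : 0 < x ->
  gamma_quo (k + l) x = gamma_quo k x * gamma_quo l (x + k%:R / 2).
Proof.
move=> x0; rewrite /gamma_quo natrD mulrDl addrA mulrA mulfVK // gt_eqF // G_gt0 //.
by rewrite ltr_wpDr // divr_ge0.
Qed.

Lemma gamma_quo2 x : 0 < x -> gamma_quo 2 x = x^-1.
Proof.
move=> x0; rewrite /gamma_quo divff // GS // invfM mulrA mulrAC mulfV ?mul1r //.
by rewrite gt_eqF // G_gt0.
Qed.

(** The lower bound is log-convexity at the midpoint [x + 1/2], the upper one at [x + 1]. Together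
    they force [gamma_quo 1 x ^+ 2 * (x + 2^-1)] to tend to 1. *)
Lemma gamma_quo1_bounds x : 0 < x ->
  x^-1 <= gamma_quo 1 x ^+ 2 <= (x + 2^-1) / x ^+ 2.
Proof.
move=> x0; have xh : 0 < x + 2^-1 by rewrite addr_gt0.
have G0 := G_gt0 x0; have Gh := G_gt0 xh.
have := G_midpoint x0; have := G_midpoint xh.
have -> : x + 2^-1 + 2^-1 = x + 1 by lra.
rewrite !GS // /gamma_quo mul1r.
set a := G x in G0 *; set b := G (x + 2^-1) in Gh * => h1 h2.
rewrite exprMn exprVn; apply/andP; split.
  rewrite ler_pdivlMr ?exprn_gt0 // mulrC ler_pdivrMr //.
  by rewrite (_ : a ^+ 2 * x = a * (x * a)) //; ring.
rewrite ler_pdivrMr ?exprn_gt0 // mulrAC ler_pdivlMr ?exprn_gt0 //.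
by rewrite -exprMn [a * x]mulrC (le_trans h1) // expr2 mulrCA.
Qed.

Lemma gamma_quo1S x : 0 < x ->
  gamma_quo 1 (x + 1) = x / (x + 2^-1) * gamma_quo 1 x.
Proof.
move=> x0; have xh : 0 < x + 2^-1 by rewrite addr_gt0.
rewrite /gamma_quo mul1r addrAC !GS // invfM.
by rewrite mulrACA.
Qed.

Lemma gamma_quoS k x : 0 < x ->
  gamma_quo k.+1 x = gamma_quo k x * gamma_quo 1 (x + k%:R / 2).
Proof. by move=> x0; rewrite -addn1 gamma_quoD. Qed.

(* [x |-> gamma_quo 1 x ^+ 2 * (x + 1/2)] is nonincreasing: its value at [y]
   over its value at [x] grows under (x, y) |-> (x + 1, y + 1) by the explicit
   recurrence, and it tends to 1 along these shifts by log-convexity. *)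
Lemma gamma_quo1_decay x y : 0 < x -> x <= y ->
  gamma_quo 1 y ^+ 2 * (y + 2^-1) <= gamma_quo 1 x ^+ 2 * (x + 2^-1).
Proof.
move=> x0 xy; have y0 : 0 < y by apply: lt_le_trans xy.
pose S (z : R) := gamma_quo 1 z ^+ 2 * (z + 2^-1).
change (S y <= S x).
have S0 (z : R) : 0 < z -> 0 < S z.
  by move=> z0; rewrite /S mulr_gt0 ?exprn_gt0 ?gamma_quo_gt0 // addr_gt0.
(* [k z] is the growth factor [S (z + 1) / S z]; the ratio [S y / S x] grows under the shift because
   [k] is nondecreasing. *)
pose k (z : R) := (z / (z + 2^-1)) ^+ 2 * ((z + 1 + 2^-1) / (z + 2^-1)).
have k0 (z : R) : 0 < z -> 0 < k z.
  move=> z0; have ? : 0 < z + 2^-1 by lra.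
  have ? : 0 < z + 1 + 2^-1 by lra.
  by rewrite /k mulr_gt0 ?exprn_gt0 ?divr_gt0.
have SS (z : R) : 0 < z -> S (z + 1) = k z * S z.
  move=> z0; rewrite /S /k gamma_quo1S // exprMn; field.
  by rewrite gt_eqF //; lra.
have kE (z : R) : 0 < z -> k z = 1 - (6 * z + 1) / (2 * z + 1) ^+ 3.
  move=> z0; rewrite /k; field.
  by rewrite gt_eqF //; lra.
have kle (u v : R) : 0 < u -> u <= v -> k u <= k v.
  move=> u0 uv; have v0 : 0 < v by lra.
  rewrite !kE // lerD2l lerN2.
  rewrite ler_pdivrMr ?exprn_gt0 //; last by lra.
  rewrite mulrAC ler_pdivlMr ?exprn_gt0 //; last by lra.
  rewrite -subr_ge0 [X in 0 <= X](_ : _ = (v - u) *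
    (48 * u * v * (u + v) + 8 * (u ^+ 2 + u * v + v ^+ 2) + 72 * u * v
     + 12 * (u + v) )); last by ring.
  by rewrite mulr_ge0 ?subr_ge0 // !addr_ge0 ?mulr_ge0 ?exprn_ge0 ?addr_ge0 ?mulr_ge0 // ltW.
have mono n : S y / S x <= S (y + n%:R) / S (x + n%:R).
  elim: n => [|n IH]; first by rewrite !addr0.
  apply: le_trans IH _.
  have xn : 0 < x + n%:R by rewrite ltr_wpDr.
  have yn : 0 < y + n%:R by rewrite ltr_wpDr.
  rewrite -natr1 !addrA !SS // -[leRHS]mulf_div.
  rewrite ler_peMl ?divr_ge0 ?(ltW (S0 _ _)) // ler_pdivlMr ?k0 // mul1r.
  by apply: kle => //; rewrite lerD2r.
rewrite -[leRHS]mul1r -ler_pdivrMr ?S0 //.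
apply/ler_addgt0Pr => e e0.
(* With [z = y + n] this gives [e * z >= 3], more than enough for the upper bound
   [(z + 1/2)^2 / z^2] to be at most [1 + e]. *)
pose n := (Num.truncn (3 / e)).+1.
have ne : 3 < e * n%:R by rewrite mulrC -ltr_pdivrMr // truncnS_gt.
have n1 : 1 <= n%:R :> R by rewrite ler1n.
apply: le_trans (mono n) _.
have xn : 0 < x + n%:R by rewrite ltr_wpDr.
have yn : 0 < y + n%:R by rewrite ltr_wpDr.
have /andP[_ Syn] := gamma_quo1_bounds yn.
have /andP[Sxn _] := gamma_quo1_bounds xn.
have Sx1 : 1 <= S (x + n%:R).
  apply: (@le_trans _ _ ((x + n%:R)^-1 * (x + n%:R))); first by rewrite mulVf // gt_eqF.
  rewrite /S; apply: ler_pM; [by rewrite invr_ge0 ltW|exact: ltW|exact: Sxn|].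
  by rewrite lerDl.
apply: (@le_trans _ _ (S (y + n%:R))).
  by rewrite ler_pdivrMr ?(lt_le_trans ltr01) // ler_peMr // ltW // S0.
set z := y + n%:R in yn Syn *.
have zn : n%:R <= z by rewrite lerDr ltW.
apply: (@le_trans _ _ ((z + 2^-1) / z ^+ 2 * (z + 2^-1))).
  by rewrite ler_pM2r //; lra.
rewrite mulrAC ler_pdivrMr ?exprn_gt0 //.
have ez : 3 <= e * z by apply: (le_trans (ltW ne)); rewrite ler_pM2l.
have ezz : 3 * z <= e * z * z by rewrite ler_pM2r.
rewrite [leRHS](_ : _ = z * z + e * z * z); last by ring.
rewrite [leLHS](_ : _ = z * z + z + 4^-1); last by field.
have : 1 <= z by apply: le_trans zn.
lra.
Qed.

Lemma gamma_quo1_noninc x y : 0 < x -> x <= y -> gamma_quo 1 y <= gamma_quo 1 x.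
Proof.
move=> x0 xy; have y0 : 0 < y by apply: lt_le_trans xy.
have h := gamma_quo1_decay x0 xy.
have qx := gamma_quo_gt0 1 x0; have qy := gamma_quo_gt0 1 y0.
rewrite -ler_sqr ?nnegrE ?(ltW qx) ?(ltW qy) //.
have yh : 0 < y + 2^-1 by lra.
rewrite -(ler_pM2r yh); apply: le_trans h _.
by rewrite ler_wpM2l ?exprn_ge0 ?(ltW qx) // lerD2r.
Qed.

Lemma gamma_quo_noninc k x y : 0 < x -> x <= y -> gamma_quo k y <= gamma_quo k x.
Proof.
move=> x0 xy; have y0 : 0 < y by apply: lt_le_trans xy.
elim: k => [|k IH]; first by rewrite !gamma_quo0.
have k0 : 0 <= k%:R / 2 :> R by rewrite divr_ge0.
have yk : 0 < y + k%:R / 2 by rewrite ltr_wpDr.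
rewrite (gamma_quoS k x0) (gamma_quoS k y0).
apply: ler_pM; [exact/ltW/gamma_quo_gt0|exact/ltW/gamma_quo_gt0|exact: IH|].
by apply: gamma_quo1_noninc; [rewrite ltr_wpDr|rewrite lerD2r].
Qed.

(** Dilation form of [- t * (ln q)' >= 1/2 * t / (t + c)] for [q t = gamma_quo 1 (t + x)].
    [gamma_quo1_decay] bounds the squared ratio by a rational function, and [1 + u <= expR u] brings
    it to exponential form. *)
Lemma gamma_quo1_scale x l t c : 0 <= x -> 0 < t -> 1 <= l -> x + 2^-1 <= c ->
  gamma_quo 1 (l * t + x) <=
  gamma_quo 1 (t + x) * expR (- ((1 - l^-1) * 2^-1 * (t / (t + c)))).
Proof.
move=> x0 t0 l1 xc; have l0 : 0 < l by apply: lt_le_trans l1.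
have tx : 0 < t + x by rewrite ltr_wpDr.
have tl : t <= l * t by rewrite ler_peMl // ltW.
have ltx : t + x <= l * t + x by rewrite lerD2r.
have ltx0 : 0 < l * t + x by apply: lt_le_trans ltx.
have c0 : 0 < c by apply: lt_le_trans xc; rewrite ltr_wpDl.
have q1 := gamma_quo_gt0 1 ltx0; have q2 := gamma_quo_gt0 1 tx.
rewrite -ler_sqr ?nnegrE ?(ltW q1) ?(mulr_ge0 (ltW q2) (expR_ge0 _)) //.
set w := expR _.
have -> : (gamma_quo 1 (t + x) * w) ^+ 2 =
   gamma_quo 1 (t + x) ^+ 2 * expR (- ((1 - l^-1) * (t / (t + c)))).
  by rewrite exprMn /w -expRM_natl; congr (_ * expR _); field; rewrite gt_eqF ?gt_eqF //; lra.
have h := gamma_quo1_decay tx ltx.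
have l2 : 0 < l * t + x + 2^-1 by lra.
rewrite -(@ler_pM2r _ (l * t + x + 2^-1)) //; apply: le_trans h _.
rewrite -[leRHS]mulrA ler_wpM2l ?exprn_ge0 ?(ltW q2) //.
rewrite -ler_pdivrMr //; apply: le_trans (expR_ge1Dx _).
rewrite ler_pdivrMr // -subr_ge0.
have tc : 0 < t + c by lra.
rewrite [X in 0 <= X](_ : _ = (l - 1) * t * (l * (c - x - 2^-1) + (l - 1) * (x + 2^-1)) / (l * (t + c))).
  have cx : 0 <= c - x - 2^-1 by lra.
  have xh : 0 <= x + 2^-1 by lra.
  have ll : 0 <= l - 1 by lra.
  apply: divr_ge0; last by rewrite mulr_ge0 ?(ltW l0) ?(ltW tc).
  by rewrite mulr_ge0 ?(mulr_ge0 ll (ltW t0)) // addr_ge0 // mulr_ge0 // ltW.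
field; rewrite !gt_eqF //.
Qed.

(** The half-steps start at [x + j / 2] for [j < k]; one [c] serves them all, since the last one
    asks exactly for [x + k / 2 <= c]. *)
Lemma gamma_quo_scale k x l t c : 0 <= x -> 0 < t -> 1 <= l -> x + k%:R / 2 <= c ->
  gamma_quo k (l * t + x) <=
  gamma_quo k (t + x) * expR (- ((1 - l^-1) * (k%:R / 2 * (t / (t + c))))).
Proof.
move=> x0 t0 l1; have l0 : 0 < l by apply: lt_le_trans l1.
have lt0 : 0 < l * t + x by rewrite ltr_wpDr // mulr_gt0.
have tx : 0 < t + x by rewrite ltr_wpDr.
elim: k => [|k IH] xc.
  by rewrite !gamma_quo0 // mul0r mul0r mulr0 oppr0 expR0 mulr1.
have k0 : 0 <= k%:R / 2 :> R by rewrite divr_ge0.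
rewrite (gamma_quoS k lt0) (gamma_quoS k tx).
have -> : - ((1 - l^-1) * (k.+1%:R / 2 * (t / (t + c)))) =
   - ((1 - l^-1) * (k%:R / 2 * (t / (t + c)))) + - ((1 - l^-1) * 2^-1 * (t / (t + c))).
  by rewrite -natr1; ring.
rewrite expRD [leRHS]mulrACA; apply: ler_pM.
- exact/ltW/gamma_quo_gt0.
- by apply/ltW/gamma_quo_gt0; rewrite ltr_wpDr.
- by apply: IH; move: xc; rewrite -natr1; lra.
rewrite -!addrA; apply: gamma_quo1_scale => //; first by rewrite addr_ge0.
by move: xc; rewrite -natr1; lra.
Qed.

(** Splitting off one whole step isolates the pole at 0, which governs the kernel when [rho = 0]. *)
Lemma gamma_quo_le_inv k x : (2 <= k)%N -> 0 < x ->
  gamma_quo k x <= gamma_quo (k - 2) 1 / x.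
Proof.
move=> k2 x0; rewrite -{1}(subnKC k2) gamma_quoD // gamma_quo2 // divff // mulrC.
by rewrite ler_wpM2r ?invr_ge0 ?(ltW x0) // gamma_quo_noninc // lerDr ltW.
Qed.

(** Each half-step contributes at most [2 * t ^ (- 1/2)], because [(t + 1/2) / t^2 <= 4 / t] for
    [t >= 1]. *)
Lemma gamma_quo_tail k x t : 0 <= x -> 1 <= t ->
  gamma_quo k (t + x) <= 2 ^+ k * t `^ (- (k%:R / 2)).
Proof.
move=> x0 t1; have t0 : 0 < t by apply: lt_le_trans t1.
have H1 : gamma_quo 1 t <= 2 * t `^ (- 2^-1).
  have q1 := gamma_quo_gt0 1 t0.
  rewrite -ler_sqr ?nnegrE ?(ltW q1) ?(mulr_ge0 _ (powR_ge0 _ _)) //.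
  have /andP[_ h] := gamma_quo1_bounds t0; apply: le_trans h _.
  rewrite exprMn -(powR_mulrn 2 (powR_ge0 t (- 2^-1))) -powRrM (_ : - 2^-1 * 2 = -1); last by lra.
  rewrite powR_inv1 ?(ltW t0) // ler_pdivrMr ?exprn_gt0 //.
  have -> : 2 ^+ 2 / t * t ^+ 2 = 4 * t by field; rewrite gt_eqF.
  by lra.
elim: k => [|k IH].
  by rewrite gamma_quo0 ?ltr_wpDr // expr0 mul1r mul0r oppr0 powRr0.
have k0 : 0 <= k%:R / 2 :> R by rewrite divr_ge0.
have tx : 0 < t + x by rewrite ltr_wpDr.
rewrite (gamma_quoS k tx) exprSr.
have -> : - (k.+1%:R / 2) = - (k%:R / 2) + - 2^-1 :> R by rewrite -natr1; lra.
rewrite powRD ?(gt_eqF t0) ?implybT // [leRHS]mulrACA; apply: ler_pM.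
- exact/ltW/gamma_quo_gt0.
- by apply/ltW/gamma_quo_gt0; rewrite ltr_wpDr.
- exact: IH.
apply: le_trans H1; apply: gamma_quo1_noninc => //.
by rewrite -addrA lerDl addr_ge0.
Qed.

End GammaQuotient.

(** * Moments of the mixing density *)

Section ScalingInequality.
Variable R : realType.
Local Notation mu := (@lebesgue_measure R).
Local Notation Ry := (`]0%R, +oo[%classic : set R).

Lemma measurable_Ry_mul (h : R -> R) (l : R) : 0 < l -> measurable_fun Ry h ->
  measurable_fun Ry (fun t => h (l * t)).
Proof.
move=> l0 mh; apply: (@measurable_comp _ _ _ _ _ _ Ry h Ry (fun t : R => l * t)) => //.
- by move=> _ [s] sR <-; move: sR; rewrite /= !in_itv /= !andbT; apply: mulr_gt0.
- exact: measurable_funM.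
Qed.

Lemma integrable_Ry_le (f h : R -> R) : measurable_fun Ry f ->
  mu.-integrable Ry (EFin \o h) -> (forall t, 0 < t -> `|f t| <= h t) ->
  mu.-integrable Ry (EFin \o f).
Proof.
move=> mf hi fh; apply: (@le_integrable _ _ _ mu Ry _ (EFin \o f) (EFin \o h)) => //.
  exact/measurable_EFinP.
move=> t; rewrite /= in_itv /= andbT => t0; rewrite lee_fin.
by apply: le_trans (fh t t0) (ler_norm _).
Qed.

(* For smooth [h] the last hypothesis says [- t h' >= w h], and the conclusion
   is integration by parts. The limit v -> 0 of the dilations t |-> e^v t gives
   it without differentiability. *)
Lemma scaling_inequality (a B : R) (h w : R -> R) : 0 <= a ->
  measurable_fun Ry h -> measurable_fun Ry w ->
  (forall t, 0 < t -> 0 <= h t) -> (forall t, 0 < t -> 0 <= w t <= B) ->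
  mu.-integrable Ry (EFin \o (fun t => t `^ a * h t)) ->
  (forall l t, 1 <= l -> 0 < t ->
     h (l * t) <= h t * expR (- ((1 - l^-1) * w t))) ->
  \int[mu]_(t in Ry) (t `^ a * h t * w t)
    <= (a + 1) * \int[mu]_(t in Ry) (t `^ a * h t).
Proof.
move=> a0 mh mw h0 wB fi hl.
pose f t := t `^ a * h t; set M := \int[mu]_(t in Ry) (t `^ a * h t).
set W := \int[mu]_(t in Ry) (t `^ a * h t * w t).
have B0 : 0 <= B by have /andP[] := wB 1 ltr01; apply: le_trans.
have f0 t : 0 < t -> 0 <= f t by move=> t0; rewrite mulr_ge0 ?powR_ge0 ?h0.
have mf : measurable_fun Ry f.
  by apply: measurable_funM => //; apply: measurable_funTS; exact: measurable_powR.
have M0 : 0 <= M by apply: Rintegral_ge0 => t; rewrite /= in_itv /= andbT => /f0.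
have W0 : 0 <= W.
  apply: Rintegral_ge0 => t; rewrite /= in_itv /= andbT => t0.
  by rewrite mulr_ge0 ?f0 //; have /andP[] := wB t t0.
have fwi : mu.-integrable Ry (EFin \o (fun t => f t * w t)).
  apply: (@integrable_Ry_le _ (fun t => B * f t)); first exact: measurable_funM.
    exact: integrable_RyZl.
  move=> t t0; have /andP[w0 w1] := wB t t0.
  rewrite ger0_norm; last exact: mulr_ge0 (f0 t t0) w0.
  by rewrite mulrC ler_wpM2r // f0.
have step (v : R) : 0 < v -> v <= 1 -> W <= (a + 1) * M * ((1 + v) * (1 + v * B)).
  (* The substitution [t |-> l * t] gives [M = l * \int f (l t)]. Bounding [f (l t)] by [hl] and
     letting [v] be small turns this into the inequality on [W]. *)
  move=> v0 v1; pose l := expR v; have l0 : 0 < l by exact: expR_gt0.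
  have l1 : 1 <= l by rewrite -expR0 ler_expR ltW.
  pose s := 1 - l^-1.
  have lV : l^-1 = expR (- v) by rewrite expRN.
  have sv : s <= v by rewrite /s lV; have := expR_ge1Dx (- v); lra.
  have s0 : v / (1 + v) <= s.
    have : l^-1 <= (1 + v)^-1 by rewrite lef_pV2 ?posrE ?expR_ge1Dx //; lra.
    have -> : v / (1 + v) = 1 - (1 + v)^-1 by field; rewrite gt_eqF //; lra.
    by rewrite /s; lra.
  have s00 : 0 <= s by apply: le_trans s0; rewrite divr_ge0 //; lra.
  (* For [0 <= u <= s * B], [expR (- u) <= 1 / (1 + u) <= 1 - u / D]: the exponential becomes linear
     in [w t] with a slope uniform in [t]. *)
  pose D := 1 + s * B; have D0 : 0 < D by rewrite ltr_wpDr ?mulr_ge0.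
  have mfl : measurable_fun Ry (fun t => f (l * t)) by exact: measurable_Ry_mul.
  have fl t : 0 < t -> f (l * t) <= l `^ a * (f t - s / D * (f t * w t)).
    move=> t0; rewrite /f powRM ?(ltW l0) ?(ltW t0) // -mulrA ler_wpM2l ?powR_ge0 //.
    have /andP[w0 w1] := wB t t0.
    rewrite [leRHS](_ : _ = t `^ a * (h t * (1 - s * w t / D))); last by ring.
    rewrite ler_wpM2l ?powR_ge0 //; apply: le_trans (hl l t l1 t0) _.
    rewrite ler_wpM2l ?h0 // expRN.
    have u0 : 0 <= s * w t by rewrite mulr_ge0.
    apply: (@le_trans _ _ (1 + s * w t)^-1).
      by rewrite lef_pV2 ?posrE ?expR_gt0 ?expR_ge1Dx // ltr_wpDr.
    have uD : s * w t <= s * B by rewrite ler_wpM2l.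
    rewrite -[leLHS]div1r ler_pdivrMr ?ltr_wpDr //.
    rewrite -subr_ge0 [X in 0 <= X](_ : _ = s * w t * (s * B - s * w t) / D).
      by apply: divr_ge0 (mulr_ge0 u0 _) (ltW D0); rewrite subr_ge0.
    by rewrite /D; field; rewrite gt_eqF.
  have gi : mu.-integrable Ry (EFin \o (fun t => l `^ a * (f t - s / D * (f t * w t)))).
    by apply: integrable_RyZl; apply: integrable_RyB => //; exact: integrable_RyZl.
  have fli : mu.-integrable Ry (EFin \o (fun t => f (l * t))).
    apply: (integrable_Ry_le mfl gi) => t t0.
    by rewrite ger0_norm ?fl // f0 // mulr_gt0.
  have ME : M = l * \int[mu]_(t in Ry) f (l * t).
    have fin1 : (\int[mu]_(t in Ry) (f (l * t))%:E)%E \is a fin_num.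
      exact: (integrable_fin_num _ fli).
    rewrite /M /Rintegral (@ge0_integral_scale _ l (EFin \o f)) //.
    - by rewrite -[in LHS](fineK fin1) -EFinM.
    - exact/measurable_EFinP.
  have : M <= l * (l `^ a * (M - s / D * W)).
    rewrite {1}ME ler_pM2l //.
    have := le_Rintegral_Ry fli gi fl.
    rewrite RintegralZl //; last first.
      by apply: integrable_RyB => //; exact: integrable_RyZl.
    rewrite RintegralB //; last exact: integrable_RyZl.
    by rewrite RintegralZl.
  have lE : l * l `^ a = expR ((a + 1) * v).
    by rewrite /l -expRM -expRD; congr expR; ring.
  rewrite mulrA lE => H.
  have H2 : (1 - (a + 1) * v) * M <= M - s / D * W.
    apply: (@le_trans _ _ (expR (- ((a + 1) * v)) * M)).
      by rewrite ler_wpM2r // expR_ge1Dx.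
    by rewrite expRN ler_pdivrMl ?expR_gt0.
  have H3 : s * W <= (a + 1) * v * M * D.
    by rewrite -ler_pdivrMr // mulrAC; lra.
  have H4 : v / (1 + v) * W <= (a + 1) * v * M * (1 + v * B).
    apply: le_trans (_ : s * W <= _); first by rewrite ler_wpM2r.
    apply: le_trans H3 _; rewrite ler_wpM2l ?mulr_ge0 ?addr_ge0 ?(ltW v0) //.
    by rewrite lerD2l ler_wpM2r.
  have v10 : 0 < 1 + v by lra.
  move: H4; rewrite mulrAC ler_pdivrMr // => H4.
  by rewrite -(ler_pM2l v0); lra.
apply/ler_addgt0Pr => e e0.
have := mulr_ge0 (addr_ge0 a0 ler01) M0.
move: ((a + 1) * M) step => L step L0.
(* For [v <= 1], [(1 + v) * (1 + v * B) <= 1 + v * (1 + 2 * B)], so the excess over [L] is at most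
   [v * C]; the added 1 keeps [C] positive when [L = 0]. *)
pose C := L * (1 + 2 * B) + 1.
have C0 : 0 < C by rewrite ltr_wpDl // mulr_ge0 // addr_ge0 // mulr_ge0.
pose v := Num.min 1 (e / C).
have v0 : 0 < v by rewrite lt_min ltr01 divr_gt0.
have v1 : v <= 1 by rewrite ge_min lexx.
have vC : v * C <= e by rewrite -ler_pdivlMr // ge_min lexx orbT.
apply: le_trans (step v v0 v1) _.
have : (1 + v) * (1 + v * B) <= 1 + v * (1 + 2 * B).
  have vv : v * (v * B) <= v * B by rewrite ler_piMl // mulr_ge0 // ltW.
  by lra.
move=> /(ler_wpM2l L0) /le_trans; apply.
rewrite mulrDr mulr1 lerD2l; apply: le_trans vC.
rewrite [leRHS](_ : _ = L * (v * (1 + 2 * B)) + v); first by rewrite lerDl ltW.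
by rewrite /C; ring.
Qed.

End ScalingInequality.

(** * Integrability and moments of the kernel *)

Section PosteriorKernel.
Variable R : realType.
Local Notation mu := (@lebesgue_measure R).
Local Notation Ry := (`]0%R, +oo[%classic : set R).
Variables (N : nat) (alpha beta rho Mg : R) (g G : R -> R) (k : 'I_N -> nat).
Hypothesis alpha_gt0 : 0 < alpha.
Hypothesis beta_ge0 : 0 <= beta.
Hypothesis g_gt0 : forall t, 0 < t -> 0 < g t.
Hypothesis g_le : forall t, 0 < t -> g t <= Mg.
Hypothesis g_noninc : forall s t, 0 < s -> s <= t -> g t <= g s.
Hypothesis G_gamma : gamma_like G.
Hypothesis rho_ge0 : 0 <= rho.
Hypothesis alphaN : rho = 0 -> N%:R < alpha.
Hypothesis k_ge2 : forall nu, (2 <= k nu)%N.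
Hypothesis alpha_k : alpha + 2 <= \sum_nu (k nu)%:R / 2.

Local Notation q j t := (gamma_quo G j (t + rho)).

(** Separated from the power of [t] because this factor is nonincreasing; it is the [h] of
    [scaling_inequality]. *)
Definition ker_factor t := expR (- (beta * t)) * g t * \prod_nu q (k nu) t.

Definition ker t :=
  t `^ (alpha - 1) * expR (- (beta * t)) * g t * \prod_nu q (k nu) t.

Local Notation h := ker_factor.
Local Notation f := ker.
Local Notation c nu := (rho + (k nu)%:R / 2).

Definition ker_mom0 := \int[mu]_(t in Ry) f t.
Definition ker_mom1 := \int[mu]_(t in Ry) (t * f t).
Definition ker_U nu := \int[mu]_(t in Ry) (f t / (t + c nu)).
Definition ker_V nu := \int[mu]_(t in Ry) (t * f t / (t + c nu)).
Definition ker_W nu := \int[mu]_(t in Ry) (t * f t * (t / (t + c nu))).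

Let Mg_ge0 : 0 <= Mg.
Proof. by apply: le_trans (g_le ltr01); rewrite ltW // g_gt0. Qed.

Let tr_gt0 t : 0 < t -> 0 < t + rho. Proof. by move=> t0; rewrite ltr_wpDr. Qed.

Let qP_gt0 t : 0 < t -> 0 < \prod_nu q (k nu) t.
Proof. by move=> t0; apply: prodr_gt0 => nu _; apply: gamma_quo_gt0 => //; exact: tr_gt0. Qed.

Let f_h t : f t = t `^ (alpha - 1) * h t. Proof. by rewrite /ker /h !mulrA. Qed.

Let h_gt0 t : 0 < t -> 0 < h t.
Proof. by move=> t0; rewrite !mulr_gt0 ?expR_gt0 ?g_gt0 ?qP_gt0. Qed.

Lemma ker_gt0 t : 0 < t -> 0 < f t.
Proof. by move=> t0; rewrite f_h mulr_gt0 ?powR_gt0 ?h_gt0. Qed.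

Let tf_h t : 0 < t -> t * f t = t `^ alpha * h t.
Proof. by move=> t0; rewrite f_h mulrA mulr_powRB1 // ltW. Qed.

(** The indices in [P] contribute their exponential decay, the others only monotonicity. The empty
    [P] gives [h_noninc]; the first [n] indices give the bound for the loss. *)
Let h_scale (P : pred 'I_N) l t : 1 <= l -> 0 < t ->
  h (l * t) <= h t *
    expR (- ((1 - l^-1) * \sum_(nu | P nu) (k nu)%:R / 2 * (t / (t + c nu)))).
Proof.
move=> l1 t0; have l0 : 0 < l by apply: lt_le_trans l1.
have tlt : t <= l * t by rewrite ler_peMl // ltW.
have lt0 : 0 < l * t by rewrite mulr_gt0.
have s0 : 0 <= 1 - l^-1 by rewrite subr_ge0 invf_le1.
rewrite /h -[leRHS]mulrA; apply: ler_pM.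
- by rewrite mulr_ge0 ?expR_ge0 // ltW // g_gt0.
- exact/ltW/qP_gt0.
- apply: ler_pM; [exact: expR_ge0|exact/ltW/g_gt0| |exact: g_noninc].
  by rewrite ler_expR lerN2 ler_wpM2l.
rewrite mulr_sumr -sumrN expR_sum [X in _ <= _ * X]big_mkcond -big_split /=.
apply: ler_prod => nu _; rewrite ltW ?gamma_quo_gt0 ?tr_gt0 //=.
case: (P nu).
  by apply: gamma_quo_scale => //; rewrite lexx.
by rewrite mulr1; apply: gamma_quo_noninc => //; rewrite ?tr_gt0 ?lerD2r.
Qed.

Let h_noninc s t : 0 < s -> s <= t -> h t <= h s.
Proof.
move=> s0 st; have := @h_scale pred0 (t / s) s.
rewrite ler_pdivlMr // mul1r mulfVK ?gt_eqF // => /(_ st s0).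
by rewrite big_pred0_eq mulr0 oppr0 expR0 mulr1.
Qed.

Let measurable_h : measurable_fun Ry h.
Proof. exact: nonincreasing_measurable_Ry. Qed.

Let measurable_f : measurable_fun Ry f.
Proof.
rewrite (_ : f = fun t => t `^ (alpha - 1) * h t); last by apply/funext => t; rewrite f_h.
apply: measurable_funM => //; apply: measurable_funTS; exact: measurable_powR.
Qed.

(** If [rho = 0], each of the [N] Gamma quotients has a pole of order one at 0, which leaves the
    exponent [alpha - N > 0]. If [rho > 0], the quotients are bounded by their values at [rho]. *)
Let f_near0 : exists C p : R, [/\ 0 < p, 0 <= C &
  forall t, 0 < t -> t <= 1 -> f t <= C * t `^ (p - 1)].
Proof.
have eg t : 0 < t -> expR (- (beta * t)) * g t <= Mg.
  move=> t0; rewrite -[leRHS]mul1r; apply: ler_pM; rewrite ?expR_ge0 ?g_le ?(ltW (g_gt0 _)) //.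
  by rewrite expR_le1 oppr_le0 mulr_ge0 // ltW.
have eg0 t : 0 < t -> 0 <= expR (- (beta * t)) * g t.
  by move=> t0; rewrite mulr_ge0 ?expR_ge0 ?(ltW (g_gt0 _)).
have [r0|r0] := eqVneq rho 0.
  pose C := \prod_nu gamma_quo G (k nu - 2) 1.
  have C0 : 0 <= C by apply: prodr_ge0 => nu _; exact/ltW/gamma_quo_gt0.
  exists (Mg * C), (alpha - N%:R); split; [by rewrite subr_gt0 alphaN|exact: mulr_ge0|].
  move=> t t0 t1; rewrite f_h /h.
  have -> : alpha - N%:R - 1 = (alpha - 1) + - N%:R by lra.
  rewrite [t `^ (alpha - 1 - _)]powRD ?(gt_eqF t0) ?implybT // [leRHS]mulrCA ler_wpM2l ?powR_ge0 //.
  rewrite -[leRHS]mulrA; apply: ler_pM; rewrite ?eg0 ?eg ?(ltW (qP_gt0 _)) //.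
  rewrite powRN powR_mulrn ?(ltW t0) // /C -exprVn -[X in _ ^+ X](card_ord N) -prodr_const -big_split /=.
  apply: ler_prod => nu _; rewrite ltW ?gamma_quo_gt0 ?tr_gt0 //= r0 addr0.
  by apply: gamma_quo_le_inv.
have rg : 0 < rho by rewrite lt_neqAle eq_sym r0.
pose C := \prod_nu gamma_quo G (k nu) rho.
have C0 : 0 <= C by apply: prodr_ge0 => nu _; exact/ltW/gamma_quo_gt0.
exists (Mg * C), alpha; split => //; first exact: mulr_ge0.
move=> t t0 t1; rewrite f_h /h mulrC ler_wpM2r ?powR_ge0 //.
apply: ler_pM; rewrite ?eg0 ?eg ?(ltW (qP_gt0 _)) //.
apply: ler_prod => nu _; rewrite ltW ?gamma_quo_gt0 ?tr_gt0 //=.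
by apply: gamma_quo_noninc => //; rewrite lerDr ltW.
Qed.

(** [t * f t] is of order at most [t ^ (alpha - \sum_nu k nu / 2)]; the 2 in [alpha_k] makes this at
    most [t ^ (- 2)]. *)
Let f_tail : exists2 C : R, 0 <= C & forall t, 1 <= t -> t * f t <= C * t `^ (- 2).
Proof.
exists (Mg * \prod_nu 2 ^+ k nu).
  by rewrite mulr_ge0 // prodr_ge0 // => nu _; rewrite exprn_ge0.
move=> t t1; have t0 : 0 < t by apply: lt_le_trans t1.
rewrite tf_h // /h.
apply: (@le_trans _ _ (t `^ alpha * (Mg * \prod_nu (2 ^+ k nu * t `^ (- ((k nu)%:R / 2)))))).
  rewrite ler_wpM2l ?powR_ge0 //; apply: ler_pM.
  - by rewrite mulr_ge0 ?expR_ge0 ?(ltW (g_gt0 _)).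
  - exact/ltW/qP_gt0.
  - rewrite -[leRHS]mul1r; apply: ler_pM; rewrite ?expR_ge0 ?g_le ?(ltW (g_gt0 _)) //.
    by rewrite expR_le1 oppr_le0 mulr_ge0 // ltW.
  - apply: ler_prod => nu _; rewrite ltW ?gamma_quo_gt0 ?tr_gt0 //=.
    exact: gamma_quo_tail.
have pE : \prod_nu t `^ (- ((k nu)%:R / 2)) = t `^ (- \sum_nu (k nu)%:R / 2).
  rewrite -sumrN; elim/big_ind2: _ => [|x y u v -> ->|//]; first by rewrite powRr0.
  by rewrite powRD // (gt_eqF t0) implybT.
rewrite big_split /= pE mulrCA -mulrA ler_wpM2l // mulrCA ler_wpM2l //.
  by rewrite prodr_ge0 // => nu _; rewrite exprn_ge0.
rewrite -powRD ?(gt_eqF t0) ?implybT // ler_powR //.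
by move: alpha_k; lra.
Qed.

(** [t * f t <= f t] below 1 and [f t <= t * f t] above 1, so a single pair of bounds serves both
    functions. *)
Lemma integrable_ker_pair : mu.-integrable Ry (EFin \o f) /\
  mu.-integrable Ry (EFin \o (fun t => t * f t)).
Proof.
have [C [p [p0 C0 hC]]] := f_near0; have [D D0 hD] := f_tail.
have f0 t : 0 < t -> 0 <= f t by move=> /ker_gt0/ltW.
have CD : C <= C + D by rewrite lerDl.
have DC : D <= C + D by rewrite lerDr.
have tail t : 1 <= t -> t * f t <= (C + D) * t `^ (- 2).
  by move=> t1; apply: le_trans (hD t t1) _; rewrite ler_wpM2r ?powR_ge0.
have near t : 0 < t -> t <= 1 -> f t <= (C + D) * t `^ (p - 1).
  by move=> t0 t1; apply: le_trans (hC t t0 t1) _; rewrite ler_wpM2r ?powR_ge0.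
have CD0 : 0 <= C + D by rewrite addr_ge0.
split; apply: (integrable_Ry p0 CD0) => //.
- by move=> t t0 t1; rewrite (ger0_norm (f0 t t0)) near.
- move=> t t1; have t0 : 0 < t by apply: lt_le_trans t1.
  rewrite (ger0_norm (f0 t t0)); apply: le_trans (tail t t1).
  by rewrite ler_peMl // f0.
- exact: measurable_funM.
- move=> t t0 t1; rewrite (ger0_norm (mulr_ge0 (ltW t0) (f0 t t0))).
  by apply: le_trans (near t t0 t1); rewrite ler_piMl // f0.
- move=> t t1; have t0 : 0 < t by apply: lt_le_trans t1.
  by rewrite (ger0_norm (mulr_ge0 (ltW t0) (f0 t t0))) tail.
Qed.

Let c_gt0 nu : 0 < c nu.
Proof.
apply: ltr_wpDl => //; apply: divr_gt0 => //.
by rewrite ltr0n; apply: leq_trans (k_ge2 nu).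
Qed.

Let mc nu : measurable_fun Ry (fun t : R => (t + c nu)^-1).
Proof.
apply: nonincreasing_measurable_Ry => s t s0 st.
have t0 : 0 < t by apply: lt_le_trans st.
by rewrite lef_pV2 ?posrE ?(addr_gt0 s0 (c_gt0 _)) ?(addr_gt0 t0 (c_gt0 _)) ?lerD2r.
Qed.

Let integrable_U nu : mu.-integrable Ry (EFin \o (fun t => f t / (t + c nu))).
Proof.
apply: (@integrable_Ry_le _ _ (fun t => (c nu)^-1 * f t)).
- exact: measurable_funM.
- by apply: integrable_RyZl; exact: (proj1 integrable_ker_pair).
- move=> t t0; have f0 := ker_gt0 t0; have tc : 0 < t + c nu by rewrite addr_gt0.
  rewrite (gtr0_norm (divr_gt0 f0 tc)) mulrC ler_wpM2r ?(ltW f0) //.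
  by rewrite lef_pV2 ?posrE ?c_gt0 // lerDr ltW.
Qed.

Let integrable_V nu : mu.-integrable Ry (EFin \o (fun t => t * f t / (t + c nu))).
Proof.
apply: (@integrable_Ry_le _ _ f).
- by apply: measurable_funM => //; apply: measurable_funM.
- exact: (proj1 integrable_ker_pair).
- move=> t t0; have f0 := ker_gt0 t0; have tc : 0 < t + c nu by rewrite addr_gt0.
  rewrite (gtr0_norm (divr_gt0 (mulr_gt0 t0 f0) tc)) ler_pdivrMr // [leRHS]mulrC ler_pM2r //.
  by rewrite lerDl ltW.
Qed.

Let integrable_W nu : mu.-integrable Ry (EFin \o (fun t => t * f t * (t / (t + c nu)))).
Proof.
apply: (@integrable_Ry_le _ _ (fun t => t * f t)).
- by apply: measurable_funM => //; apply: measurable_funM.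
- exact: (proj2 integrable_ker_pair).
- move=> t t0; have f0 := ker_gt0 t0; have tc : 0 < t + c nu by rewrite addr_gt0.
  have tf0 := mulr_gt0 t0 f0.
  rewrite (gtr0_norm (mulr_gt0 tf0 (divr_gt0 t0 tc))) ler_piMr ?(ltW tf0) //.
  by rewrite ler_pdivrMr // mul1r lerDl ltW.
Qed.

Lemma ker_mom0_gt0 : 0 < ker_mom0.
Proof. by apply: Rintegral_Ry_gt0; [exact: (proj1 integrable_ker_pair)|exact: ker_gt0]. Qed.

Lemma ker_mom1_gt0 : 0 < ker_mom1.
Proof.
apply: Rintegral_Ry_gt0; first exact: (proj2 integrable_ker_pair).
by move=> t t0; exact: mulr_gt0 t0 (ker_gt0 t0).
Qed.

Lemma ker_U_gt0 nu : 0 < ker_U nu.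
Proof.
apply: Rintegral_Ry_gt0 => // t t0.
by apply: divr_gt0; [exact: ker_gt0|rewrite addr_gt0].
Qed.

Lemma ker_V_gt0 nu : 0 < ker_V nu.
Proof.
apply: Rintegral_Ry_gt0 => // t t0.
by apply: divr_gt0; [exact: mulr_gt0 t0 (ker_gt0 t0)|rewrite addr_gt0].
Qed.

Let eq_Rintegral_Ry (u v : R -> R) : (forall t, 0 < t -> u t = v t) ->
  \int[mu]_(t in Ry) u t = \int[mu]_(t in Ry) v t.
Proof.
by move=> uv; apply: eq_Rintegral => t; rewrite inE /= in_itv /= andbT => /uv.
Qed.

(** [1 = t / (t + c) + c / (t + c)] under the integral; [ker_mom1E] is the same with one more power
    of [t]. *)
Lemma ker_mom0E nu : ker_mom0 = ker_V nu + c nu * ker_U nu.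
Proof.
rewrite /ker_U -RintegralZl // -RintegralD //; last exact: integrable_RyZl.
apply: eq_Rintegral_Ry => t t0; have tc : t + c nu != 0 by rewrite gt_eqF // addr_gt0.
by move: (c nu) (f t) tc => x y tc; field.
Qed.

Lemma ker_mom1E nu : ker_mom1 = ker_W nu + c nu * ker_V nu.
Proof.
rewrite /ker_V -RintegralZl // -RintegralD //; last exact: integrable_RyZl.
apply: eq_Rintegral_Ry => t t0; have tc : t + c nu != 0 by rewrite gt_eqF // addr_gt0.
by move: (c nu) (f t) tc => x y tc; field.
Qed.

(** [(k / 2) / (t + rho + k / 2)] increases in [k]. This supplies one of the two monotonicities for
    Chebyshev's inequality. *)
Lemma ker_W_mono nu nu' : (k nu <= k nu')%N ->
  (k nu)%:R / 2 * ker_W nu <= (k nu')%:R / 2 * ker_W nu'.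
Proof.
move=> kk; rewrite -!RintegralZl //.
apply: le_Rintegral_Ry; try exact: integrable_RyZl.
move=> t t0; rewrite mulrCA [leRHS]mulrCA ler_wpM2l ?(mulr_ge0 (ltW t0) (ltW (ker_gt0 t0))) //.
rewrite mulrCA [leRHS]mulrCA ler_wpM2l ?(ltW t0) //.
have kR : (k nu)%:R / 2 <= (k nu')%:R / 2 :> R by rewrite ler_pM2r ?invr_gt0 // ler_nat.
have tr := tr_gt0 t0.
have c1 : 0 < t + c nu by rewrite addr_gt0.
have c2 : 0 < t + c nu' by rewrite addr_gt0.
rewrite ler_pdivrMr // mulrAC ler_pdivlMr //.
have := ler_wpM2l (ltW tr) kR; lra.
Qed.

(** [scaling_inequality] with exponent [alpha], since [t * f t = t ^ alpha * h t], and with the rate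
    [w] of [h_scale]. *)
Lemma ker_W_sum (P : pred 'I_N) :
  \sum_(nu | P nu) (k nu)%:R / 2 * ker_W nu <= (alpha + 1) * ker_mom1.
Proof.
have [fi tfi] := integrable_ker_pair.
pose w t := \sum_(nu | P nu) (k nu)%:R / 2 * (t / (t + c nu)).
have mw : measurable_fun Ry w.
  rewrite (_ : w = fun t => \sum_nu (if P nu then (k nu)%:R / 2 * (t / (t + c nu)) else 0)).
    apply: measurable_sum => nu; case: (P nu) => //.
    by apply: measurable_funM => //; apply: measurable_funM.
  by apply/funext => t; rewrite /w big_mkcond.
have wB t : 0 < t -> 0 <= w t <= \sum_(nu | P nu) (k nu)%:R / 2.
  move=> t0; have tc nu : 0 < t + c nu by rewrite addr_gt0.
  apply/andP; split.
    apply: sumr_ge0 => nu _; rewrite mulr_ge0 ?divr_ge0 ?(ltW t0) ?(ltW (tc _)) //.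
  apply: ler_sum => nu _; rewrite ler_piMr ?divr_ge0 //.
  by rewrite ler_pdivrMr // mul1r lerDl ltW.
have hi : mu.-integrable Ry (EFin \o (fun t => t `^ alpha * h t)).
  apply: eq_integrable tfi => // t.
  by rewrite inE /= in_itv /= andbT => t0; rewrite tf_h.
have := scaling_inequality (ltW alpha_gt0) measurable_h mw
  (fun t t0 => ltW (h_gt0 t0)) wB hi (fun l t l1 t0 => h_scale P l1 t0).
have -> : \int[mu]_(t in Ry) (t `^ alpha * h t) = ker_mom1.
  by apply: eq_Rintegral_Ry => t t0; rewrite tf_h.
apply: le_trans; rewrite le_eqVlt; apply/orP; left; apply/eqP.
transitivity (\int[mu]_(t in Ry) \sum_(nu | P nu) (k nu)%:R / 2 * (t * f t * (t / (t + c nu)))); last first.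
  apply: eq_Rintegral_Ry => t t0; rewrite mulr_sumr; apply: eq_bigr => nu _.
  by rewrite tf_h // mulrCA.
pose F nu t := (k nu)%:R / 2 * (t * f t * (t / (t + c nu))).
have Fi nu : mu.-integrable Ry (EFin \o F nu) by exact: integrable_RyZl.
(* The induction carries integrability along with the equality, because additivity of the integral
   asks for it at each step. *)
suff H (s : seq 'I_N) : mu.-integrable Ry (EFin \o (fun t => \sum_(nu <- s | P nu) F nu t)) /\
    \sum_(nu <- s | P nu) (k nu)%:R / 2 * ker_W nu =
    \int[mu]_(t in Ry) \sum_(nu <- s | P nu) F nu t.
  by have [_] := H (index_enum 'I_N).
elim: s => [|nu s [IH1 IH2]].
  have -> : (fun t => \sum_(nu <- [::] | P nu) F nu t) = cst 0.
    by apply/funext => t; rewrite big_nil.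
  split; first exact: integrable0.
  by rewrite big_nil Rintegral_cst // mul0r.
have [Pnu|Pnu] := boolP (P nu); last first.
  rewrite big_cons (negbTE Pnu).
  have -> // : (fun t => \sum_(j <- nu :: s | P j) F j t) =
      fun t => \sum_(j <- s | P j) F j t.
  by apply/funext => t; rewrite big_cons (negbTE Pnu).
rewrite big_cons Pnu.
have -> : (fun t => \sum_(j <- nu :: s | P j) F j t) =
    fun t => F nu t + \sum_(j <- s | P j) F j t.
  by apply/funext => t; rewrite big_cons Pnu.
split; first exact: integrable_RyD.
by rewrite RintegralD // IH2 RintegralZl.
Qed.

End PosteriorKernel.

(** * The functionals [K] as kernel moments *)

Section KernelIntegrals.
Variable R : realType.
Variables (N : nat) (alpha beta rho : R) (g : R -> R) (k : 'I_N -> nat).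
Hypothesis rho_ge0 : 0 <= rho.

Let kcol : 'cV[R]_N := \col_nu ((k nu)%:R / 2).

Let Kpow (t : R) : 0 < t -> t `^ (alpha + 1 - 1) = t * t `^ (alpha - 1).
Proof.
move=> t0; rewrite -[X in X * _](powRr1 (ltW t0)) -powRD ?(gt_eqF t0) ?implybT //.
by congr (_ `^ _); ring.
Qed.

Let prodE (t : R) : \prod_(nu < N) (Gamma (t + rho) / Gamma (t + rho + kcol nu 0)) =
  \prod_nu gamma_quo (@Gamma R) (k nu) (t + rho).
Proof. by apply: eq_bigr => nu _; rewrite mxE. Qed.

Lemma K_mom0 : K alpha beta g rho kcol = ker_mom0 alpha beta rho g (@Gamma R) k.
Proof. by rewrite /K; apply: eq_Rintegral => t _; rewrite prodE. Qed.

Lemma K_mom1 : K (alpha + 1) beta g rho kcol = ker_mom1 alpha beta rho g (@Gamma R) k.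
Proof.
rewrite /K; apply: eq_Rintegral => t; rewrite inE /= in_itv /= andbT => t0.
by rewrite prodE Kpow // /ker !mulrA.
Qed.

(** Raising the entry [nu] by one replaces [Gamma x] by [Gamma (x + 1) = x * Gamma x] in one
    denominator. *)
Let prod_deltaE nu (t : R) : 0 < t ->
  \prod_(nu' < N) (Gamma (t + rho) / Gamma (t + rho + (kcol + delta_mx nu 0) nu' 0)) =
  (\prod_nu gamma_quo (@Gamma R) (k nu) (t + rho)) / (t + (rho + (k nu)%:R / 2)).
Proof.
move=> t0; rewrite (bigD1 nu) //= [in RHS](bigD1 nu) //= [RHS]mulrAC; congr (_ * _).
  have x0 : 0 < t + rho + (k nu)%:R / 2.
    by rewrite -addrA ltr_wpDr // addr_ge0 // divr_ge0.
  have -> : t + rho + (kcol + delta_mx nu 0) nu 0 = t + rho + (k nu)%:R / 2 + 1.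
    by rewrite !mxE !eqxx addrA.
  by rewrite [in RHS]addrA /gamma_quo GammaS // invfM [_^-1 / _]mulrC mulrA.
apply: eq_bigr => nu' nn; congr (_ / Gamma (_ + _)).
by rewrite !mxE (negbTE nn) addr0.
Qed.

Lemma K_U nu : K alpha beta g rho (kcol + delta_mx nu 0) =
  ker_U alpha beta rho g (@Gamma R) k nu.
Proof.
rewrite /K; apply: eq_Rintegral => t; rewrite inE /= in_itv /= andbT => t0.
by rewrite prod_deltaE // mulrA.
Qed.

Lemma K_V nu : K (alpha + 1) beta g rho (kcol + delta_mx nu 0) =
  ker_V alpha beta rho g (@Gamma R) k nu.
Proof.
rewrite /K; apply: eq_Rintegral => t; rewrite inE /= in_itv /= andbT => t0.
by rewrite prod_deltaE // Kpow // /ker !mulrA.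
Qed.

End KernelIntegrals.

(** * The pointwise inequality *)

(** Summing the hypothesis over all pairs gives twice the difference of the two sides. *)
Lemma chebyshev_sum (R : realDomainType) (I : finType) (P : pred I) (w x : I -> R) :
  (forall i j, P i -> P j -> 0 <= (w i - w j) * (x i - x j)) ->
  (\sum_(i | P i) w i) * (\sum_(i | P i) x i) <= #|P|%:R * \sum_(i | P i) w i * x i.
Proof.
move=> H; set n := #|P|; set S := \sum_(i | P i) w i * x i.
set Sw := \sum_(i | P i) w i; set Sx := \sum_(i | P i) x i.
have : 0 <= \sum_(i | P i) \sum_(j | P j) (w i - w j) * (x i - x j).
  by apply: sumr_ge0 => i Pi; apply: sumr_ge0 => j Pj; exact: H.
have -> : \sum_(i | P i) \sum_(j | P j) (w i - w j) * (x i - x j) =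
    \sum_(i | P i) (n%:R * (w i * x i) + S - w i * Sx - x i * Sw).
  apply: eq_bigr => i Pi.
  transitivity (\sum_(j | P j) (w i * x i + w j * x j - w i * x j - x i * w j)).
    by apply: eq_bigr => j _; ring.
  by rewrite !sumrB big_split /= sumr_const -!mulr_sumr mulr_natl.
rewrite !sumrB big_split /= -mulr_sumr -!mulr_suml sumr_const -/n -/S -/Sw -/Sx.
by rewrite -(mulr_natl S); lra.
Qed.

(** With [c = r + 1/2 + z] this says [z / ((c - 3/2) * (c - 1)) <= (z + 5/2) / c^2]. Comparing
    orders as [z] grows forces the constant 5/2; the lower-order terms are then nonnegative for
    [r >= 3/2]. *)
Lemma rate_gap (R : realFieldType) (r m z : R) : 3 / 2 <= r -> 5 <= m -> 1 <= z ->
  (m - 5) / 2 / (r + 2^-1 + z) ^+ 2 + z / ((r + z - 1) * (r + z - 2^-1)) <=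
  (z + m / 2) / (r + 2^-1 + z) ^+ 2.
Proof.
move=> hr hm hz.
have c0 : 0 < r + 2^-1 + z by lra.
have d0 : 0 < (r + z - 1) * (r + z - 2^-1) by apply: mulr_gt0; lra.
rewrite -lerBrDl -mulrBl.
have -> : z + m / 2 - (m - 5) / 2 = z + 5 / 2 by lra.
rewrite ler_pdivrMr // mulrAC ler_pdivlMr ?exprn_gt0 //.
have y0 : 0 <= (r - 3 / 2) * (r + z) by apply: mulr_ge0; lra.
rewrite -subr_ge0 [X in 0 <= X](_ : _ = 5 / 2 * ((r - 3 / 2) * (r + z)) + z / 4 + 5 / 4).
  by lra.
by field.
Qed.

Section ShrinkageInequality.
Variables (R : realType) (N m : nat) (r alpha D : R) (z : 'I_N -> nat).
Variables (P : pred 'I_N) (v W : 'I_N -> R).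
Hypothesis r_ge : 3 / 2 <= r.
Hypothesis m_ge : 5 <= m%:R :> R.
Hypothesis D_gt0 : 0 < D.

Local Notation c nu := (r + 2^-1 + (z nu)%:R).
Local Notation b nu := ((z nu)%:R + m%:R / 2).

Hypothesis D_split : forall nu, D = W nu + c nu * v nu.
Hypothesis W_mono : forall nu nu', (z nu <= z nu')%N -> b nu * W nu <= b nu' * W nu'.
Hypothesis W_sum : \sum_(nu | P nu) b nu * W nu <= (alpha + 1) * D.
Hypothesis alpha_le : alpha + 1 <= #|P|%:R * (m%:R - 5) / 2.

Lemma shrinkage_pointwise :
  \sum_(nu | P nu) (z nu)%:R / (r + (z nu)%:R - 1) * ln (1 + D / (c nu - 1))
  <= \sum_(nu | P nu) b nu / c nu * v nu.
Proof.
have := r_ge; have := m_ge => hm hr.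
have c0 nu : 0 < c nu by have := ler0n R (z nu); lra.
(* [w] is the Chebyshev weight, and [x nu] the slack of index [nu] in [W_sum] when the bound is
   shared equally over [P]. *)
pose w nu : R := (c nu ^+ 2)^-1.
pose x nu : R := (m%:R - 5) / 2 * D - b nu * W nu.
have w0 nu : 0 < w nu by rewrite invr_gt0 exprn_gt0.
have w_anti nu nu' : (z nu <= z nu')%N -> w nu' <= w nu.
  move=> zz; rewrite /w lef_pV2 ?posrE ?exprn_gt0 //.
  by rewrite ler_sqr ?nnegrE ?(ltW (c0 _)) // lerD2l ler_nat.
have x_anti nu nu' : (z nu <= z nu')%N -> x nu' <= x nu.
  by move=> zz; rewrite /x lerD2l lerN2 W_mono.
have Sx : 0 <= \sum_(nu | P nu) x nu.
  rewrite sumrB sumr_const subr_ge0; apply: le_trans W_sum _.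
  rewrite -[leRHS]mulr_natl [leRHS]mulrA ler_wpM2r ?(ltW D_gt0) //.
  by rewrite mulrA.
have Swx : 0 <= \sum_(nu | P nu) w nu * x nu.
  have [P0|P0] := posnP #|P|.
    by rewrite big_pred0 // => nu; apply: (card0_eq P0).
  rewrite -(pmulr_rge0 _ (_ : 0 < #|P|%:R :> R)) ?ltr0n //.
  apply: le_trans (chebyshev_sum _).
    by rewrite mulr_ge0 // sumr_ge0 // => nu _; exact: ltW.
  move=> i j _ _; case: (leqP (z i) (z j)) => [ij|/ltnW ji].
    by apply: mulr_ge0; rewrite subr_ge0 ?w_anti ?x_anti.
  rewrite [X in 0 <= X](_ : _ = (w j - w i) * (x j - x i)); last by ring.
  by apply: mulr_ge0; rewrite subr_ge0 ?w_anti ?x_anti.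
rewrite -subr_ge0 -sumrB; apply: le_trans Swx _; apply: ler_sum => nu _.
have vE : v nu = (D - W nu) / c nu.
  by rewrite [X in (X - _) / _](D_split nu) addrC addKr mulrAC mulfV ?mul1r // gt_eqF.
(* Since [v = (D - W) / c], adding and subtracting [(m - 5) / 2 * D] isolates the slack; what
   remains is compared index by index. *)
have E : b nu / c nu * v nu = w nu * x nu + (b nu - (m%:R - 5) / 2) / c nu ^+ 2 * D.
  rewrite vE /w /x; move: (c nu) (b nu) (c0 nu) => y b' y0.
  by field; rewrite gt_eqF.
rewrite E -addrA lerDl subr_ge0.
(* [rate_gap] needs [z >= 1]. At [z = 0] the logarithmic term is absent and
   [b nu - (m - 5) / 2 = 5/2]. *)
have [z0|zp] := posnP (z nu).
  rewrite z0 mul0r mul0r mulr_ge0 ?(ltW D_gt0) // divr_ge0 ?exprn_ge0 //; lra.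
have z1 : 1 <= (z nu)%:R :> R by rewrite ler1n.
have cm : 0 < c nu - 1 by lra.
have rz : 0 < r + (z nu)%:R - 1 by lra.
have lnD : ln (1 + D / (c nu - 1)) <= D / (c nu - 1).
  by apply: le_ln1Dx; apply: (@lt_trans _ _ 0); rewrite ?ltrN10 // divr_gt0.
apply: (@le_trans _ _ ((z nu)%:R / (r + (z nu)%:R - 1) * (D / (c nu - 1)))).
  by rewrite ler_wpM2l // divr_ge0 // ltW.
have -> : (z nu)%:R / (r + (z nu)%:R - 1) * (D / (c nu - 1)) =
    (z nu)%:R / ((r + (z nu)%:R - 1) * (r + (z nu)%:R - 2^-1)) * D.
  have -> : c nu - 1 = r + (z nu)%:R - 2^-1 by field.
  by rewrite invfM; ring.
rewrite ler_wpM2r ?(ltW D_gt0) // [leRHS]mulrBl lerBrDl.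
exact: rate_gap.
Qed.

End ShrinkageInequality.

(** * The correction terms of the estimator *)

Section DeltaFacts.
Variables (R : realType) (m N n : nat) (r alpha beta : R) (g : R -> R).
Hypothesis r_gt0 : 0 < r.
Hypothesis alpha_gt0 : 0 < alpha.
Hypothesis beta_ge0 : 0 <= beta.
Hypothesis g_gt0 : forall t, 0 < t -> 0 < g t.
Hypothesis g_bounded : exists M : R, forall t, 0 < t -> `|g t| <= M.
Hypothesis g_noninc : forall s t, 0 < s -> s <= t -> g t <= g s.
Hypothesis n_bounds : (1 <= n <= N)%N.
Hypothesis r_cases : (m%:R - 1) / 2 < r \/ r = (m%:R - 1) / 2 /\ N%:R < alpha.
Hypothesis alpha_n : alpha + 1 <= n%:R * (m%:R - 5) / 2.

Local Notation a0 := ((1 - m%:R) / 2 : R).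
Local Notation a := (const_mx (1 / 2) : 'cV[R]_m).
Local Notation del := (delta r alpha beta g a0 a).
Local Notation rho := (r + a0).
Local Notation c z nu := (r + 2^-1 + (z nu 0)%:R : R).
Implicit Types z : 'cV[nat]_N.

Let kz z (nu : 'I_N) := ((z nu 0%R).*2 + m)%N.

Let m_gt5 : 5 < m%:R :> R.
Proof.
have n0 : 0 < n%:R :> R by rewrite ltr0n; case/andP: n_bounds.
rewrite -subr_gt0 -(pmulr_rgt0 _ n0).
move: alpha_n alpha_gt0; move: (n%:R * _) => x; lra.
Qed.

Let rho_ge0 : 0 <= rho.
Proof. by case: r_cases => [|[]]; lra. Qed.

Let r_ge2 : 2 <= r.
Proof. by have := m_gt5; case: r_cases => [|[]]; lra. Qed.

Let alphaN : rho = 0 -> N%:R < alpha.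
Proof. by case: r_cases => [|[]]; lra. Qed.

Let kzE z nu : (kz z nu)%:R / 2 = (z nu 0)%:R + m%:R / 2 :> R.
Proof. by rewrite /kz natrD -muln2 natrM; lra. Qed.

Let kz_ge2 z nu : (2 <= kz z nu)%N.
Proof.
rewrite /kz; apply: leq_trans (leq_addl _ _).
by rewrite -(ler_nat R); apply: ltW; apply: lt_trans m_gt5; lra.
Qed.

(** The term [- 5 n / 2] in the bound on [alpha + 1] absorbs the extra 1, as [n >= 1], and [n <= N]
    does the rest. *)
Let alpha_kz z : alpha + 2 <= \sum_nu (kz z nu)%:R / 2.
Proof.
apply: (@le_trans _ _ (\sum_(nu < N) m%:R / 2)); last first.
  by apply: ler_sum => nu _; rewrite kzE lerDr.
rewrite sumr_const card_ord -[leRHS]mulr_natl.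
have /andP[n1 nN] := n_bounds.
have n1R : 1 <= n%:R :> R by rewrite ler1n.
have : n%:R * (m%:R / 2) <= N%:R * (m%:R / 2) :> R by rewrite ler_wpM2r ?divr_ge0 ?ler_nat.
by move: alpha_n; lra.
Qed.

Let cE z nu : rho + (kz z nu)%:R / 2 = c z nu.
Proof. by rewrite kzE; lra. Qed.

Let adotE : adot a = m%:R / 2 :> R.
Proof.
rewrite /adot (eq_bigr (fun=> 2^-1)) => [|i _]; last by rewrite mxE mul1r.
by rewrite sumr_const card_ord -[LHS]mulr_natl.
Qed.

Let GG := gamma_like_Gamma R.
Local Notation M0 z := (ker_mom0 alpha beta rho g (@Gamma R) (kz z)).
Local Notation M1 z := (ker_mom1 alpha beta rho g (@Gamma R) (kz z)).
Local Notation U z := (ker_U alpha beta rho g (@Gamma R) (kz z)).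
Local Notation V z := (ker_V alpha beta rho g (@Gamma R) (kz z)).
Local Notation W z := (ker_W alpha beta rho g (@Gamma R) (kz z)).

Let delUV z nu : del nu z = V z nu / U z nu.
Proof.
rewrite /delta /=.
have -> : map_mx (fun k => k%:R) z + const_mx (adot a) + delta_mx nu 0 =
    (\col_nu ((kz z nu)%:R / 2) : 'cV[R]_N) + delta_mx nu 0.
  by congr (_ + _); apply/matrixP => i j; rewrite !mxE kzE adotE ord1.
by rewrite (K_V _ _ _ _ rho_ge0) (K_U _ _ _ _ rho_ge0).
Qed.

Let delM z nu : del nu z = M1 (z + delta_mx nu 0) / M0 (z + delta_mx nu 0).
Proof.
rewrite /delta /= -K_mom0 -K_mom1.
have -> // : map_mx (fun k => k%:R) z + const_mx (adot a) + delta_mx nu 0 =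
    \col_nu' ((kz (z + delta_mx nu 0) nu')%:R / 2) :> 'cV[R]_N.
by apply/matrixP => i j; rewrite [RHS]mxE kzE adotE !mxE ord1 natrD addrAC natn.
Qed.

Lemma delta_gt0 z nu : 0 < del nu z.
Proof.
have [Mg hM] := g_bounded.
have g_le t : 0 < t -> g t <= Mg by move=> t0; apply: le_trans (ler_norm _) (hM t t0).
rewrite delUV divr_gt0 //.
  exact: (ker_V_gt0 alpha_gt0 beta_ge0 g_gt0 g_le g_noninc GG rho_ge0 alphaN (kz_ge2 z) (alpha_kz z)).
exact: (ker_U_gt0 alpha_gt0 beta_ge0 g_gt0 g_le g_noninc GG rho_ge0 alphaN (kz_ge2 z) (alpha_kz z)).
Qed.

(* Truncated subtraction: [lower z nu] is [z - e_nu] only when [0 < z nu]. *)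
Definition lower z (nu : 'I_N) : 'cV[nat]_N := \col_j (z j 0%R - (j == nu))%N.

Lemma lowerK z nu : (0 < z nu 0%R)%N -> lower z nu + delta_mx nu 0 = z.
Proof.
move=> z0; apply/matrixP => i j; rewrite !mxE !ord1 eqxx andbT.
by have [->|_] := eqVneq i nu; [exact: subnK|rewrite subn0 addr0].
Qed.

(** The sum over [i] of the differences between the old and the new entries of column [nu]: what
    shrinking takes off the linear part of the loss. *)
Definition shift_loss z nu : R :=
  ((z nu 0)%:R + m%:R / 2) * (del nu z / (c z nu * (c z nu + del nu z))).

(** What shrinking adds through the logarithm, after the shift: the [x_i / (r + z - 1)] add up to
    [z / (r + z - 1)], and [c] at [z - e_nu] is [c - 1]. *)
Definition shift_gain z nu : R :=
  (z nu 0)%:R / (r + (z nu 0)%:R - 1) * ln (1 + del nu (lower z nu) / (c z nu - 1)).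

Let c_gt0 z nu : 0 < c z nu.
Proof. by have := ler0n R (z nu 0); have := r_gt0; lra. Qed.

Lemma shift_loss_gt0 z nu : 0 < shift_loss z nu.
Proof.
rewrite /shift_loss; move: (del nu z) (delta_gt0 z nu) (c_gt0 z nu) => y d0 c0; apply: mulr_gt0.
  by have := ler0n R (z nu 0); have := m_gt5; lra.
by apply: divr_gt0 => //; apply: mulr_gt0 => //; apply: addr_gt0.
Qed.

(** [z + m / 2 <= c] amounts to [rho >= 0]. The bound makes the expected reduction finite without
    any moment of the sample. *)
Lemma shift_loss_le1 z nu : shift_loss z nu <= 1.
Proof.
rewrite /shift_loss; move: (del nu z) (delta_gt0 z nu) (c_gt0 z nu) => y d0 c0.
have cd : 0 < c z nu * (c z nu + y) by apply: mulr_gt0 => //; apply: addr_gt0.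
rewrite mulrA ler_pdivrMr // mul1r; apply: ler_pM.
- by rewrite addr_ge0 // divr_ge0.
- exact: ltW d0.
- by have := rho_ge0; lra.
- by rewrite lerDr (ltW c0).
Qed.

Lemma shift_gain_le_loss z :
  \sum_(nu < N | (nu < n)%N) shift_gain z nu <= \sum_(nu < N | (nu < n)%N) shift_loss z nu.
Proof.
have [Mg hM] := g_bounded.
have g_le t : 0 < t -> g t <= Mg by move=> t0; apply: le_trans (ler_norm _) (hM t t0).
have H := (ker_mom0_gt0 alpha_gt0 beta_ge0 g_gt0 g_le g_noninc GG rho_ge0 alphaN (kz_ge2 z) (alpha_kz z)).
have H1 := (ker_mom1_gt0 alpha_gt0 beta_ge0 g_gt0 g_le g_noninc GG rho_ge0 alphaN (kz_ge2 z) (alpha_kz z)).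
have E0 := ker_mom0E alpha_gt0 beta_ge0 g_gt0 g_le g_noninc GG rho_ge0 alphaN (kz_ge2 z) (alpha_kz z).
have E1 := ker_mom1E alpha_gt0 beta_ge0 g_gt0 g_le g_noninc GG rho_ge0 alphaN (kz_ge2 z) (alpha_kz z).
have EW := ker_W_mono alpha_gt0 beta_ge0 g_gt0 g_le g_noninc GG rho_ge0 alphaN (kz_ge2 z) (alpha_kz z).
have ES := ker_W_sum alpha_gt0 beta_ge0 g_gt0 g_le g_noninc GG rho_ge0 alphaN (kz_ge2 z) (alpha_kz z).
have HU := ker_U_gt0 alpha_gt0 beta_ge0 g_gt0 g_le g_noninc GG rho_ge0 alphaN (kz_ge2 z) (alpha_kz z).
have dM nu : (0 < z nu 0%R)%N -> del nu (lower z nu) = M1 z / M0 z.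
  by move=> z0; rewrite delM lowerK.
have dUV nu := delUV z nu.
rewrite /shift_gain /shift_loss.
move: (fun nu => del nu (lower z nu)) (fun nu => del nu z) dM dUV => dl dz.
move: (M0 z) (M1 z) (U z) (V z) (W z) H H1 E0 E1 EW ES HU => x0 x1 u v w H H1 E0 E1 EW ES HU dM dUV.
have r32 : 3 / 2 <= r by have := r_ge2; lra.
have := @shrinkage_pointwise R N m r alpha (x1 / x0) (fun nu => z nu 0%R)
  (fun nu => (nu < n)%N) (fun nu => v nu / x0) (fun nu => w nu / x0)
  r32 (ltW m_gt5) (divr_gt0 H1 H).
have iM : 0 <= x0^-1 by rewrite invr_ge0 ltW.
move=> main.
rewrite (eq_bigr (fun nu => (z nu 0)%:R / (r + (z nu 0)%:R - 1) *
    ln (1 + x1 / x0 / (c z nu - 1)))); last first.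
  (* At [z nu = 0] truncated subtraction makes [lower] meaningless, but the factor [z nu] removes
     the term. *)
  move=> nu _; have [z0|zp] := posnP (z nu 0%R); last by rewrite dM.
  by move: (ln _) (ln _) => l1 l2; rewrite z0 !mul0r.
rewrite [leRHS](eq_bigr (fun nu => ((z nu 0)%:R + m%:R / 2) / c z nu * (v nu / x0))); last first.
  move=> nu _; rewrite dUV -mulrA; congr (_ * _).
  (* With [del = v / u], [del / (c + del) = v / (v + c * u)], and the denominator is [x0]. *)
  have := E0 nu; rewrite cE => E0n.
  have := HU nu; have := H; rewrite E0n; move: (v nu) (u nu) (c_gt0 z nu) => x y.
  move: (c z nu) => q q0 s0 y0; field.
  by rewrite !gt_eqF //; rewrite addrC.
apply: main.
- by move=> nu; rewrite (E1 nu) cE mulrDl mulrA.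
- move=> nu nu' zz; rewrite mulrA [leRHS]mulrA ler_wpM2r //.
  by rewrite -!kzE; apply: EW; rewrite /kz leq_add2r leq_double.
- rewrite mulrA; under eq_bigr do rewrite mulrA -kzE.
  by rewrite -mulr_suml ler_wpM2r.
- rewrite (_ : #|_| = n) //.
  have /andP[_ nN] := n_bounds.
  by rewrite -sum1_card -(big_ord_widen N (fun=> 1%N) nN) sum1_card card_ord.
Qed.

End DeltaFacts.

(** * Risks *)

Section CountableExpectation.
Context {d : measure_display} {T : measurableType d} {R : realType}.
Variables (S : countType) (P : probability T R) (Y : T -> S).
Hypothesis mY : forall s, measurable [set w | Y w = s].

Lemma measurable_preimage_countable (A : set S) : measurable (Y @^-1` A).
Proof.
rewrite (_ : Y @^-1` A = \bigcup_(s in A) [set w | Y w = s]); last first.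
  by apply/seteqP; split=> w /= => [Aw|[s As ->//]]; exists (Y w).
rewrite bigcup_mkcond; apply: countable_bigcupT_measurable; first exact: countableP.
by move=> s; case: ifP.
Qed.

Lemma measurable_fun_countable d' (T' : measurableType d') (f : S -> T') :
  measurable_fun setT (fun w => f (Y w)).
Proof.
move=> _ B mB; rewrite setTI.
exact: (measurable_preimage_countable (f @^-1` B)).
Qed.

(** The space is cut into the fibres of the code of [Y]. A number that codes no value has an empty
    fibre and a zero term. *)
Lemma integral_countable (f : S -> R) : (forall s, 0 <= f s) ->
  (\int[P]_w (f (Y w))%:E =
   \esum_(s in [set: S]) ((f s)%:E * P [set w | Y w = s]))%E.
Proof.
move=> f0; pose F k := [set w | pickle (Y w) = k].
pose a k : \bar R :=
  if pickle_inv k is Some s then ((f s)%:E * P [set w | Y w = s])%E else 0%E.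
have a0 k : (0 <= a k)%E.
  rewrite /a; case: (pickle_inv k) => // s.
  by rewrite mule_ge0 // lee_fin.
have FE k : F k = if pickle_inv k is Some s then [set w | Y w = s] else set0.
  apply/seteqP; split=> w /=.
    by move=> <-; rewrite pickleK_inv.
  case E : (pickle_inv k) => [s|] //= Yw; rewrite /F /= Yw.
  by have := @pickle_invK S k; rewrite /ocancel E.
have mF k : measurable (F k).
  by rewrite FE; case: (pickle_inv k).
have FT : \bigcup_k F k = setT.
  by apply/seteqP; split=> // w _; exists (pickle (Y w)).
rewrite -[X in integral _ X _]FT ge0_integral_bigcup //; last 3 first.
- by rewrite FT; apply/measurable_EFinP; exact: (measurable_fun_countable f).
- by move=> w _; rewrite lee_fin.
- by move=> i j _ _ [w [/= <- <-]].
rewrite (eq_eseriesr (g := a)); last first.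
  move=> k _; rewrite (eq_integral (fun=> (if pickle_inv k is Some s then f s else 0)%:E)).
    rewrite integral_cst // FE /a.
    by case: (pickle_inv k) => [s|] //; rewrite mul0e.
  by move=> w; rewrite inE /F /= => <-; rewrite pickleK_inv.
rewrite nneseries_esumT //.
transitivity (\esum_(k in [set pickle s | s in [set: S]]) a k)%E.
  rewrite [RHS]esum_mkcond; apply: eq_esum => k _.
  case: ifPn => //; rewrite notin_setE /= => nk.
  rewrite /a; case E : (pickle_inv k) => [s|] //.
  by exfalso; apply: nk; exists s => //; have := @pickle_invK S k; rewrite /ocancel E.
rewrite esum_image; last by move=> s s' _ _ /(pcan_inj pickleK_inv).
by apply: eq_esum => s _; rewrite /a pickleK_inv.
Qed.

End CountableExpectation.

(** The shift is injective, and it misses only matrices with a zero entry at [(i, nu)], where [a]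
    vanishes. *)
Lemma esum_shift_matrix (R : realType) (m N : nat) (i : 'I_m) (nu : 'I_N)
    (a : 'M[nat]_(m, N) -> \bar R) :
  (forall y : 'M[nat]_(m, N), y i nu = 0%N -> a y = 0%E) ->
  (\esum_(x in [set: 'M[nat]_(m, N)]) a (x + delta_mx i nu)%R =
   \esum_(y in [set: 'M[nat]_(m, N)]) a y)%E.
Proof.
move=> a0; pose e (x : 'M[nat]_(m, N)) := x + delta_mx i nu.
rewrite -(@esum_image _ _ _ [set: 'M[nat]_(m, N)] e); last first.
  move=> x y _ _ /matrixP xy; apply/matrixP => j k.
  by have := xy j k; rewrite !mxE => /addIn.
rewrite [LHS]esum_mkcond; apply: eq_esum => y _; case: ifPn => //.
rewrite notin_setE => ny; rewrite a0 //.
apply/eqP; rewrite -leqn0 leqNgt; apply/negP => y0; apply: ny.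
exists (\matrix_(j, k) (y j k - ((j == i) && (k == nu)))%N) => //.
apply/matrixP => j k; rewrite !mxE.
case: andP => [[/eqP -> /eqP ->]|_]; first exact: subnK.
by rewrite subn0 addr0.
Qed.

(** * The negative multinomial mass function *)

Section NegativeMultinomial.
Variables (R : realType) (m : nat) (r : R).
Hypothesis r_gt0 : 0 < r.
Implicit Types (q : 'cV[R]_m) (y : 'cV[nat]_m).

Lemma NM_pmf_gt0 q y : Dset q -> 0 < NM_pmf r q y.
Proof.
move=> [q0 q1]; rewrite /NM_pmf.
have rs : 0 < r + (\sum_(i < m) y i ord0)%N%:R by rewrite ltr_wpDr.
have f0 : 0 < \prod_(i < m) (y i ord0)`!%:R :> R.
  by apply: prodr_gt0 => i _; rewrite ltr0n fact_gt0.
apply: mulr_gt0; last by apply: prodr_gt0 => i _; rewrite exprn_gt0.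
apply: mulr_gt0; last by rewrite powR_gt0 // subr_gt0.
by apply: divr_gt0; [exact: Gamma_gt0|apply: mulr_gt0 => //; exact: Gamma_gt0].
Qed.

Lemma NM_pmf_shift q y (i : 'I_m) :
  NM_pmf r q (y + delta_mx i 0) * (y i 0).+1%:R =
  q i 0 * (r + (\sum_(j < m) y j ord0)%N%:R) * NM_pmf r q y.
Proof.
have yE j : (y + delta_mx i 0) j ord0 = (y j ord0 + (j == i))%N.
  by rewrite !mxE eqxx andbT natn.
have SE : (\sum_(j < m) (y + delta_mx i 0)%R j ord0 = (\sum_(j < m) y j ord0).+1)%N.
  rewrite (eq_bigr _ (fun j _ => yE j)) big_split /= -[RHS]addn1; congr addn.
  by rewrite (bigD1 i) //= eqxx big1 // => j /negbTE ->.
have FE : \prod_(j < m) ((y + delta_mx i 0)%R j ord0)`!%:R =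
    (y i ord0).+1%:R * \prod_(j < m) (y j ord0)`!%:R :> R.
  rewrite (bigD1 i) //= [in RHS](bigD1 i) //= yE eqxx addn1 factS natrM -mulrA.
  by congr (_ * (_ * _)); apply: eq_bigr => j /negbTE ji; rewrite yE ji addn0.
have QE : \prod_(j < m) q j 0 ^+ (y + delta_mx i 0)%R j ord0 =
    q i 0 * \prod_(j < m) q j 0 ^+ y j ord0.
  rewrite (bigD1 i) //= [in RHS](bigD1 i) //= yE eqxx addn1 exprS -mulrA.
  by congr (_ * (_ * _)); apply: eq_bigr => j /negbTE ji; rewrite yE ji addn0.
rewrite /NM_pmf SE FE QE -natr1 addrA.
set s := (\sum_(j < m) y j ord0)%N.
have rs : 0 < r + s%:R by rewrite ltr_wpDr.
rewrite GammaS //; have f0 : \prod_(j < m) (y j ord0)`!%:R != 0 :> R.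
  by rewrite gt_eqF //; apply: prodr_gt0 => j _; rewrite ltr0n fact_gt0.
have := gt_eqF (Gamma_gt0 r_gt0).
move: (Gamma (r + s%:R)) (Gamma r) (\prod_(j < m) (y j ord0)`!%:R) f0 => G1 G2 F f0 G20.
move: (_ `^ r) (\prod_(j < m) _) => a b.
have k0 : (y i 0).+1%:R != 0 :> R by rewrite pnatr_eq0.
move: (_.+1%:R) k0 => k k0.
by field; rewrite f0 k0 G20.
Qed.

(** Exponential tilting: a factor 2 per count replaces [q] by [2 q], up to a constant. It controls
    functions that grow at most like a power of 2. *)
Lemma NM_pmf_double q y :
  0 < 1 - \sum_(i < m) (2 *: q) i 0 ->
  NM_pmf r q y * 2 ^+ (\sum_(i < m) y i ord0)%N =
  (1 - \sum_(i < m) q i 0) `^ r / (1 - \sum_(i < m) (2 *: q) i 0) `^ r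
  * NM_pmf r (2 *: q) y.
Proof.
move=> q20; rewrite /NM_pmf.
have -> : \prod_(i < m) (2 *: q) i 0 ^+ y i ord0 =
    2 ^+ (\sum_(i < m) y i ord0)%N * \prod_(i < m) q i 0 ^+ y i ord0.
  rewrite -prodrXr -big_split /=; apply: eq_bigr => i _.
  by rewrite mxE exprMn.
have := gt_eqF (powR_gt0 r q20).
move: (_ `^ r) => B B0; move: (_ `^ r) (2 ^+ _) (\prod_(i < m) q i 0 ^+ _) => A D E.
move: (Gamma _ / _) => C.
by field; rewrite B0.
Qed.

End NegativeMultinomial.

(** * The joint law of the sample *)

Section Model.
Context {d : measure_display} {T : measurableType d} {R : realType}.
Variables (m N : nat) (r : R) (P : 'M[R]_(m, N) -> probability T R).
Variable X : T -> 'M[nat]_(m, N).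
Hypothesis r_gt0 : 0 < r.
Hypothesis model : NM_model r P X.
Implicit Types (p : 'M[R]_(m, N)) (x : 'M[nat]_(m, N)).

Definition NM_weight p x : R := \prod_(nu < N) NM_pmf r (col nu p) (col nu x).

Lemma NM_weight_gt0 p x : Dmx p -> 0 < NM_weight p x.
Proof. by move=> Dp; apply: prodr_gt0 => nu _; exact: NM_pmf_gt0. Qed.

Lemma measurable_sample x : measurable [set w | X w = x].
Proof.
have [mX _ _] := model.
rewrite (_ : [set w | X w = x] = \bigcap_(ij in [set: 'I_m * 'I_N])
    ((fun w => X w ij.1 ij.2) @^-1` [set x ij.1 ij.2])).
  apply: fin_bigcap_measurable => // -[i j] _.
  by rewrite -[X in measurable X]setTI; apply: mX.
apply/seteqP; split=> w /=; first by move=> <- [i j] _.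
by move=> h; apply/matrixP => i j; exact: (h (i, j)).
Qed.

Lemma prob_sample p x : Dmx p -> P p [set w | X w = x] = (NM_weight p x)%:E.
Proof.
have [_ ind law] := model; move=> Dp.
have := ind p Dp (fun nu => [set col nu x]).
rewrite (_ : [set w | forall nu, [set col nu x] (col nu (X w))] = [set w | X w = x]); last first.
  apply/seteqP; split=> w /=; last by move=> ->.
  by move=> h; apply/matrixP => i j; have /matrixP/(_ i 0) := h j; rewrite !mxE.
move=> ->; rewrite /NM_weight.
rewrite (eq_bigr (fun nu => (NM_pmf r (col nu p) (col nu x))%:E)); last first.
  by move=> nu _; exact: law.
by elim/big_ind2: _ => // a b c e -> ->; rewrite EFinM.
Qed.

Lemma integral_sample p (f : 'M[nat]_(m, N) -> R) : Dmx p -> (forall x, 0 <= f x) ->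
  (\int[P p]_w (f (X w))%:E = \esum_(x in [set: 'M[nat]_(m, N)]) (f x * NM_weight p x)%:E)%E.
Proof.
move=> Dp f0; rewrite (integral_countable _ measurable_sample f0).
by apply: eq_esum => x _; rewrite EFinM -prob_sample.
Qed.

Lemma measurable_sample_fun (f : 'M[nat]_(m, N) -> R) :
  measurable_fun setT (fun w => (f (X w))%:E).
Proof. by apply/measurable_EFinP; exact: measurable_fun_countable measurable_sample _ _ _. Qed.

Lemma Xdot_shift x i nu : Xdot (x + delta_mx i nu) = Xdot x + delta_mx nu 0.
Proof.
apply/matrixP => j k; rewrite !mxE ord1 eqxx andbT natn.
under eq_bigr do rewrite !mxE natn.
rewrite big_split /=; congr addn.
rewrite (bigD1 i) //= eqxx /= big1 ?addn0 // => l /negbTE -> //.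
Qed.

Lemma NM_weight_shift p x i nu :
  NM_weight p (x + delta_mx i nu) * (x i nu).+1%:R =
  p i nu * (r + (Xdot x nu 0)%:R) * NM_weight p x.
Proof.
have colE k : col k (x + delta_mx i nu) = if k == nu then col nu x + delta_mx i 0 else col k x.
  case: eqVneq => [->|kn]; apply/matrixP => a b; rewrite !mxE ?ord1 ?eqxx ?andbT //.
  by rewrite (negbTE kn) andbF addr0.
rewrite /NM_weight (bigD1 nu) //= [in RHS](bigD1 nu) //= colE eqxx mulrAC.
have := NM_pmf_shift r_gt0 (col nu p) (col nu x) i.
have -> : col nu x i 0 = x i nu by rewrite mxE.
have -> : col nu p i 0 = p i nu by rewrite mxE.
have -> : (\sum_(j < m) col nu x j ord0)%N = Xdot x nu 0.
  by rewrite mxE; apply: eq_bigr => j _; rewrite mxE.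
move: (NM_pmf _ _ _) (NM_pmf _ _ _) => f1 f2 ->.
rewrite -[LHS]mulrA; congr (_ * (_ * _)).
by apply: eq_bigr => k /negbTE kn; rewrite colE kn.
Qed.

End Model.

(** * Bounds on the loss *)

Section Loss.
Variables (R : realType) (m N n : nat).
Implicit Types (e p : 'M[R]_(m, N)).

Lemma Dmx_gt0 p i nu : Dmx p -> 0 < p i nu.
Proof. by move=> Dp; have [/(_ i)] := Dp nu; rewrite mxE. Qed.

Lemma loss_term_ge0 (x y : R) : 0 < x -> 0 < y -> 0 <= x - y - y * ln (x / y).
Proof.
move=> x0 y0; rewrite -addrA -opprD subr_ge0.
have xy : 0 < x / y by rewrite divr_gt0.
have h : ln (x / y) <= x / y - 1.
  by rewrite (_ : x / y = 1 + (x / y - 1)) ?addrK; [apply: le_trans (le_ln1Dx _) _; lra|ring].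
have := ler_wpM2l (ltW y0) h.
by rewrite mulrBr mulr1 mulrCA mulfV ?gt_eqF // mulr1; lra.
Qed.

(** A crude bound through [- ln (x / y) <= y / x], enough for finiteness of a risk. *)
Lemma loss_term_le (x y : R) : 0 < x -> x <= 1 -> 0 < y -> y <= 1 ->
  x - y - y * ln (x / y) <= 1 + x^-1.
Proof.
move=> x0 x1 y0 y1; have u0 : 0 < x / y by rewrite divr_gt0.
have lnV : - ln (x / y) <= x^-1.
  rewrite -lnV ?posrE // invf_div; apply: (@le_trans _ _ (y / x)).
    by apply: ltW; apply: ln_sublinear; rewrite divr_gt0.
  by rewrite ler_piMl // invr_ge0 ltW.
have h := ler_wpM2l (ltW y0) lnV; rewrite mulrN in h.
have : y * x^-1 <= x^-1 by rewrite ler_piMl // invr_ge0 ltW.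
by lra.
Qed.

Lemma linear_le_scaled (r x s t : R) : 0 < r -> x <= s -> s <= t -> 1 <= t ->
  1 + 2 * (r + 2^-1 + x) <= (2 * r + 4) * t.
Proof. by move=> r0 xs st t1; have := ler_wpM2l (ltW r0) t1; lra. Qed.

Lemma Ltilde_ge0 e p : (forall i nu, 0 < e i nu) -> Dmx p -> 0 <= Ltilde n e p.
Proof.
move=> e0 Dp; apply: sumr_ge0 => nu _; apply: sumr_ge0 => i _.
by apply: loss_term_ge0 => //; exact: Dmx_gt0.
Qed.

End Loss.

(** * Comparison of the risks *)

Section Domination.
Context {d : measure_display} {T : measurableType d} {R : realType}.
Variables (m N n : nat) (r alpha beta : R) (g : R -> R).
Variables (P : 'M[R]_(m, N) -> probability T R) (X : T -> 'M[nat]_(m, N)).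
Hypothesis r_gt0 : 0 < r.
Hypothesis alpha_gt0 : 0 < alpha.
Hypothesis beta_ge0 : 0 <= beta.
Hypothesis g_gt0 : forall t, 0 < t -> 0 < g t.
Hypothesis g_bounded : exists M : R, forall t, 0 < t -> `|g t| <= M.
Hypothesis g_noninc : forall s t, 0 < s -> s <= t -> g t <= g s.
Hypothesis n_bounds : (1 <= n <= N)%N.
Hypothesis r_cases : (m%:R - 1) / 2 < r \/ r = (m%:R - 1) / 2 /\ N%:R < alpha.
Hypothesis alpha_n : alpha + 1 <= n%:R * (m%:R - 5) / 2.
Hypothesis model : NM_model r P X.
Implicit Types (p : 'M[R]_(m, N)) (x y : 'M[nat]_(m, N)) (z : 'cV[nat]_N).

Local Notation a0 := ((1 - m%:R) / 2 : R).
Local Notation a := (const_mx (1 / 2) : 'cV[R]_m).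
Local Notation del := (delta r alpha beta g a0 a).
Local Notation c z nu := (r + 2^-1 + (z nu 0)%:R : R).
Local Notation e0 := (est0 r a0 a).
Local Notation e1 := (est r alpha beta g a0 a).
Local Notation gain := (shift_gain m r alpha beta g).
Local Notation loss := (shift_loss m r alpha beta g).
Local Notation EE p f :=
  (\esum_(x in [set: 'M[nat]_(m, N)]) (f x * NM_weight r p x)%:E)%E.

Let del_gt0 z nu : 0 < del nu z.
Proof. exact: (delta_gt0 alpha_gt0 beta_ge0 g_gt0 g_bounded g_noninc n_bounds r_cases alpha_n). Qed.

Let loss_gt0 z nu : 0 < loss z nu.
Proof. exact: (shift_loss_gt0 r_gt0 alpha_gt0 beta_ge0 g_gt0 g_bounded g_noninc n_bounds r_cases alpha_n). Qed.

Let loss_le1 z nu : loss z nu <= 1.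
Proof. exact: (shift_loss_le1 r_gt0 alpha_gt0 beta_ge0 g_gt0 g_bounded g_noninc n_bounds r_cases alpha_n). Qed.

Let gain_le_loss z :
  \sum_(nu < N | (nu < n)%N) gain z nu <= \sum_(nu < N | (nu < n)%N) loss z nu.
Proof. exact: (shift_gain_le_loss r_gt0 alpha_gt0 beta_ge0 g_gt0 g_bounded g_noninc n_bounds r_cases alpha_n). Qed.

Let m_gt0 : 0 < m%:R :> R.
Proof.
case: (posnP m) => [m0|]; last by rewrite ltr0n.
move: alpha_n; rewrite m0 sub0r mulrN mulNr => h.
have : 0 <= n%:R * 5 / 2 :> R by rewrite divr_ge0 ?mulr_ge0.
by have := alpha_gt0; lra.
Qed.

Let c_gt0 z nu : 0 < c z nu.
Proof. by have := ler0n R (z nu 0); have := r_gt0; lra. Qed.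

Let r_ge : m%:R / 2 <= r + 2^-1.
Proof. by case: r_cases => [|[]]; lra. Qed.

Let den x nu : r + a0 + (Xdot x nu 0)%:R + adot a = c (Xdot x) nu.
Proof.
have -> : adot a = m%:R / 2.
  rewrite /adot (eq_bigr (fun=> 2^-1)) => [|i _]; last by rewrite mxE mul1r.
  by rewrite sumr_const card_ord -[LHS]mulr_natl.
by lra.
Qed.

Let e0E x i nu : e0 x i nu = ((x i nu)%:R + 2^-1) / c (Xdot x) nu.
Proof. by rewrite mxE den mxE mul1r. Qed.

Let e1E x i nu : e1 x i nu = ((x i nu)%:R + 2^-1) / (c (Xdot x) nu + del nu (Xdot x)).
Proof. by rewrite mxE den mxE mul1r. Qed.

Let cd_gt0 z nu : 0 < c z nu + del nu z.
Proof. exact: addr_gt0 (c_gt0 z nu) (del_gt0 z nu). Qed.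

Let xh_gt0 x i nu : 0 < (x i nu)%:R + 2^-1 :> R.
Proof. by have := ler0n R (x i nu); lra. Qed.

Let e0_gt0 x i nu : 0 < e0 x i nu.
Proof. by rewrite e0E; exact: divr_gt0 (xh_gt0 x i nu) (c_gt0 _ nu). Qed.

Let e1_gt0 x i nu : 0 < e1 x i nu.
Proof. by rewrite e1E; exact: divr_gt0 (xh_gt0 x i nu) (cd_gt0 _ nu). Qed.

Let logq z nu := ln (1 + del nu z / c z nu).

Let logq_ge0 z nu : 0 <= logq z nu.
Proof. by apply: ln_ge0; rewrite lerDl; exact: ltW (divr_gt0 (del_gt0 z nu) (c_gt0 z nu)). Qed.

Let A x := \sum_(nu < N | (nu < n)%N) loss (Xdot x) nu.
Let B p x := \sum_(nu < N | (nu < n)%N) \sum_(i < m) p i nu * logq (Xdot x) nu.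
Let Gn x := \sum_(nu < N | (nu < n)%N) gain (Xdot x) nu.

(** [1 + del / c] is the ratio of the old entry to the new one, so the logarithms differ by [logq].
    The additive form stays usable when the expectations are infinite. *)
Let loss_split p x : Dmx p ->
  Ltilde n (e1 x) p + A x = Ltilde n (e0 x) p + B p x.
Proof.
move=> Dp; rewrite /A /B /Ltilde -!big_split /=; apply: eq_bigr => nu _.
have -> : loss (Xdot x) nu = \sum_(i < m) ((x i nu)%:R + 2^-1) *
    (del nu (Xdot x) / (c (Xdot x) nu * (c (Xdot x) nu + del nu (Xdot x)))).
  rewrite /shift_loss -mulr_suml; congr (_ * _).
  rewrite big_split /= sumr_const card_ord -[X in _ = _ + X]mulr_natl; congr (_ + _).
  by rewrite mxE natr_sum.
rewrite -!big_split /=; apply: eq_bigr => i _.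
rewrite /logq e0E e1E.
have := Dmx_gt0 i nu Dp; have := xh_gt0 x i nu.
move: (del nu (Xdot x)) (del_gt0 (Xdot x) nu) (c_gt0 (Xdot x) nu) => D D0.
move: (c (Xdot x) nu) (p i nu) ((x i nu)%:R + 2^-1) => C q y C0 y0 q0.
have CD0 : 0 < C + D by rewrite addr_gt0.
have -> : y / C / q = y / (C + D) / q * (1 + D / C).
  by field; rewrite !gt_eqF.
have h1 : 0 < y / (C + D) / q by rewrite !divr_gt0.
have h2 : 0 < 1 + D / C by apply: addr_gt0 => //; exact: divr_gt0.
have -> : ln (y / (C + D) / q * (1 + D / C)) = ln (y / (C + D) / q) + ln (1 + D / C).
  by rewrite lnM ?posrE.
move: (ln _) (ln _) => l1 l2.
have -> : y / C = y / (C + D) + y * (D / (C * (C + D))).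
  by field; rewrite !gt_eqF.
by ring.
Qed.

Let A_ge0 x : 0 <= A x.
Proof. by apply: sumr_ge0 => nu _; exact: ltW. Qed.

Let B_ge0 p x : Dmx p -> 0 <= B p x.
Proof.
by move=> Dp; apply: sumr_ge0 => nu _; apply: sumr_ge0 => i _; rewrite mulr_ge0 // ltW // Dmx_gt0.
Qed.

Let gain_ge0 z nu : 0 <= gain z nu.
Proof.
rewrite /shift_gain; have [z0|z0] := posnP (z nu 0%R).
  by move: (ln _) => l; rewrite z0 !mul0r.
have z1 : 1 <= (z nu 0)%:R :> R by rewrite ler1n.
have := r_gt0 => r0.
apply: mulr_ge0; first by rewrite divr_ge0 //; lra.
apply: ln_ge0; rewrite lerDl; apply: ltW; apply: divr_gt0 (del_gt0 _ _) _; lra.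
Qed.

(** For fixed [nu] and [i], the summand at [x] is [G] at [x] with its entry [(i, nu)] raised by one;
    [G] vanishes where that entry is 0, so reindexing loses nothing. *)
Let shift_identity p : Dmx p -> (EE p (B p) = EE p Gn)%E.
Proof.
move=> Dp.
have w0 x : 0 <= NM_weight r p x by exact/ltW/NM_weight_gt0.
pose G nu i y := ((y i nu)%:R / (r + (Xdot y nu 0)%:R - 1) *
   ln (1 + del nu (lower (Xdot y) nu) / (c (Xdot y) nu - 1)) * NM_weight r p y)%:E.
have G0 nu i y : (0 <= G nu i y)%E.
  rewrite /G lee_fin; apply: mulr_ge0 => //.
  have [z0|z0] := posnP (y i nu).
    by move: (ln _) => l; rewrite z0 !mul0r.
  have z1 : 1 <= (Xdot y nu 0)%:R :> R.
    by rewrite ler1n mxE (bigD1 i) //= addn_gt0 z0.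
  have := r_gt0 => r0.
  apply: mulr_ge0; first by rewrite divr_ge0 //; lra.
  apply: ln_ge0; rewrite lerDl; apply: ltW; apply: divr_gt0 (del_gt0 _ _) _; lra.
transitivity (\esum_(x in [set: 'M[nat]_(m, N)]) (\sum_(nu < N | (nu < n)%N) \sum_(i < m)
    (p i nu * logq (Xdot x) nu * NM_weight r p x)%:E)%E)%E.
  apply: eq_esum => x _; rewrite /B mulr_suml -sumEFin; apply: eq_bigr => nu _.
  by rewrite mulr_suml -sumEFin.
transitivity (\esum_(y in [set: 'M[nat]_(m, N)]) (\sum_(nu < N | (nu < n)%N) \sum_(i < m)
    G nu i y)%E)%E; last first.
  apply: eq_esum => y _; rewrite /Gn mulr_suml -sumEFin; apply: eq_bigr => nu _.
  rewrite sumEFin; congr EFin; rewrite -mulr_suml /shift_gain; congr (_ * _).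
  rewrite -mulr_suml; congr (_ * _); rewrite -mulr_suml; congr (_ / _).
  by rewrite -natr_sum mxE.
have t0 x nu i : (0 <= (p i nu * logq (Xdot x) nu * NM_weight r p x)%:E)%E.
  rewrite lee_fin; apply: mulr_ge0 => //; apply: mulr_ge0 => //.
  exact/ltW/Dmx_gt0.
rewrite esum_sum; last by move=> x nu _ _; apply: sume_ge0 => i _.
rewrite esum_sum; last by move=> x nu _ _; apply: sume_ge0 => i _.
apply: eq_bigr => nu _; rewrite esum_sum // esum_sum //; apply: eq_bigr => i _.
rewrite -(@esum_shift_matrix _ _ _ i nu (G nu i)); last first.
  by move=> y y0; rewrite /G y0; move: (ln _) => l; rewrite !mul0r.
apply: eq_esum => x _; rewrite /G; congr EFin.
have rX : 0 < r + (Xdot x nu 0)%:R by rewrite ltr_wpDr.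
have -> : (x + delta_mx i nu) i nu = (x i nu).+1.
  by rewrite !mxE !eqxx natn -addn1.
rewrite Xdot_shift.
have -> : lower (Xdot x + delta_mx nu 0) nu = Xdot x.
  apply/matrixP => j k; rewrite mxE [((_ + _) : 'cV[nat]_N) _ _]mxE [delta_mx _ _ _ _]mxE ord1 andbT natn.
  by rewrite addnK.
have -> : ((Xdot x + delta_mx nu 0)%R nu 0)%:R = (Xdot x nu 0)%:R + 1 :> R.
  by rewrite [((_ + _) : 'cV[nat]_N) _ _]mxE [delta_mx _ _ _ _]mxE !eqxx natrD.
have -> : r + 2^-1 + ((Xdot x nu 0)%:R + 1) - 1 = c (Xdot x) nu by ring.
have -> : r + ((Xdot x nu 0)%:R + 1) - 1 = r + (Xdot x nu 0)%:R by ring.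
rewrite -/(logq (Xdot x) nu); have := NM_weight_shift r_gt0 p x i nu.
move: (NM_weight r p _) (NM_weight r p x) (logq _ _) (_.+1%:R) (p i nu) => w1 w2 l k q E.
rewrite [RHS](_ : _ = w1 * k * l / (r + (Xdot x nu 0)%:R)); last by ring.
by rewrite E; field; rewrite gt_eqF.
Qed.

Let EA_fin p : Dmx p -> (EE p A < +oo)%E.
Proof.
move=> Dp; have A1 x : A x <= N%:R.
  apply: (@le_trans _ _ (\sum_(nu < N) 1)); last by rewrite sumr_const card_ord.
  rewrite /A big_mkcond; apply: ler_sum => nu _; case: ifP => // _; exact: loss_le1.
rewrite -(integral_sample model Dp A_ge0).
apply: (@le_lt_trans _ _ (\int[P p]_w (N%:R)%:E)%E).
  apply: ge0_le_integral => //.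
  - by move=> w _; rewrite lee_fin.
  - exact: (measurable_sample_fun model A).
  - by move=> w _; rewrite lee_fin.
by rewrite integral_cst // -[X in (_ * X)%E]/(P _ setT) probability_setT mule1 ltry.
Qed.

Let risk_sum p (e : 'M[nat]_(m, N) -> 'M[R]_(m, N)) : Dmx p ->
  (forall x i nu, 0 < e x i nu) ->
  risk P X (@Ltilde R m N n) e p = (EE p (fun x => Ltilde n (e x) p))%E.
Proof.
move=> Dp e_gt0; rewrite /risk expectation.unlock.
by rewrite -(integral_sample model Dp) // => x; apply: Ltilde_ge0.
Qed.

Let esumD_weight p (f h : 'M[nat]_(m, N) -> R) : Dmx p ->
  (forall x, 0 <= f x) -> (forall x, 0 <= h x) ->
  (EE p (fun x => (f x + h x)%R) = EE p f + EE p h)%E.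
Proof.
move=> Dp f0 h0; rewrite -esumD => [|x _|x _]; last 2 first.
- by rewrite lee_fin mulr_ge0 // ltW // NM_weight_gt0.
- by rewrite lee_fin mulr_ge0 // ltW // NM_weight_gt0.
by apply: eq_esum => x _; rewrite mulrDl EFinD.
Qed.

Let risk_balance p : Dmx p ->
  (EE p (fun x => Ltilde n (e1 x) p) + EE p A =
   EE p (fun x => Ltilde n (e0 x) p) + EE p Gn)%E.
Proof.
move=> Dp; rewrite -shift_identity //.
rewrite -!esumD_weight //; try by move=> x; apply: Ltilde_ge0.
  by apply: eq_esum => x _; rewrite loss_split.
by move=> x; exact: B_ge0.
Qed.

Let EG_le_EA p : Dmx p -> (EE p Gn <= EE p A)%E.
Proof.
move=> Dp; apply: le_esum => x _; rewrite lee_fin ler_wpM2r ?gain_le_loss //.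
by rewrite ltW // NM_weight_gt0.
Qed.

(** The observation 0 has positive mass, and there [Gn] is 0 while [A] is positive. *)
Let EG_lt_EA p : Dmx p -> (EE p Gn < EE p A)%E.
Proof.
move=> Dp.
have Gn0 x : 0 <= Gn x by apply: sumr_ge0 => nu _.
have -> : (EE p A = EE p Gn + EE p (fun x => (A x - Gn x)%R))%E.
  rewrite -esumD_weight // => [|x]; last by rewrite subr_ge0 gain_le_loss.
  by apply: eq_esum => x _; rewrite addrC subrK.
have fin : EE p Gn \is a fin_num.
  rewrite ge0_fin_numE; first exact: le_lt_trans (EG_le_EA Dp) (EA_fin Dp).
  by apply: esum_ge0 => x _; rewrite lee_fin mulr_ge0 // ltW // NM_weight_gt0.
rewrite lteDl //.
have AG : 0 < (A 0 - Gn 0) * NM_weight r p 0.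
  rewrite mulr_gt0 ?NM_weight_gt0 // subr_gt0.
  have -> : Gn 0 = 0.
    rewrite /Gn big1 // => nu _; rewrite /shift_gain.
    have -> : Xdot (0 : 'M[nat]_(m, N)) nu 0 = 0%N.
      by rewrite mxE big1 // => i _; rewrite mxE.
    by move: (ln _) => l; rewrite !mul0r.
  have /andP[n1 nN] := n_bounds.
  rewrite /A (bigD1 (Ordinal (leq_trans n1 nN))) //=.
  by rewrite ltr_wpDr // sumr_ge0 // => nu _; exact: ltW.
apply: (@lt_le_trans _ _ ((A 0 - Gn 0) * NM_weight r p 0)%:E); first by rewrite lte_fin.
apply: esum_ge; exists [set 0]; first by split.
by rewrite fsbig_set1.
Qed.

(** The columns of [p1] sum to [m / (2 * (m + 1)) < 1/2], so [2 *: p1] is still a parameter. *)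
Let p1 : 'M[R]_(m, N) := const_mx (2 * (m%:R + 1))^-1.

Let Dp1 (k : R) : 0 < k -> k <= 2 -> Dmx (k *: p1).
Proof.
move=> k0 k2 nu; have m1 : 0 < 2 * (m%:R + 1) :> R by rewrite mulr_gt0 // addr_gt0.
split; first by move=> i; rewrite !mxE mulr_gt0 // invr_gt0.
rewrite (eq_bigr (fun=> k / (2 * (m%:R + 1)))) => [|i _]; last by rewrite !mxE.
rewrite sumr_const card_ord -[X in X < _]mulr_natl mulrA ltr_pdivrMr // mul1r.
have := ler_wpM2l (ltW m_gt0) k2; lra.
Qed.

Let weight_double : exists2 C : R, 0 <= C & forall x,
  2 ^+ (\sum_(nu < N) Xdot x nu 0%R)%N * NM_weight r p1 x = C * NM_weight r (2 *: p1) x.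
Proof.
pose C nu := (1 - \sum_(i < m) col nu p1 i 0) `^ r /
  (1 - \sum_(i < m) (2 *: col nu p1) i 0) `^ r.
exists (\prod_nu C nu).
  by apply: prodr_ge0 => nu _; rewrite divr_ge0 ?powR_ge0.
move=> x; rewrite /NM_weight -prodrXr -!big_split /=; apply: eq_bigr => nu _.
have colE : col nu (2 *: p1) = 2 *: col nu p1 by apply/matrixP => i j; rewrite !mxE.
rewrite mulrC colE -NM_pmf_double.
  by congr (_ * _ ^+ _); rewrite mxE; apply: eq_bigr => i _; rewrite mxE.
have two0 : 0 < 2 :> R by [].
by rewrite -colE subr_gt0; have [_] := Dp1 two0 (lexx _) nu.
Qed.

(** Each of the at most [N * m] loss terms grows at most linearly in the sample, hence is below
    [(2 * r + 4) * 2 ^ s]. By [weight_double] the risk is then below the expectation of a constant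
    under [2 *: p1]. *)
Let risk0_fin : (EE p1 (fun x => Ltilde n (e0 x) p1) < +oo)%E.
Proof.
have Dp : Dmx p1 by rewrite -[p1]scale1r; apply: Dp1 => //; rewrite ler1n.
have Dp2 : Dmx (2 *: p1) by apply: Dp1.
have [C C0 hC] := weight_double.
pose K : R := N%:R * (m%:R * (2 * r + 4)).
have K0 : 0 <= K by rewrite !mulr_ge0 // addr_ge0 // mulr_ge0 // ltW.
have LK x : Ltilde n (e0 x) p1 <= K * 2 ^+ (\sum_(nu < N) Xdot x nu 0%R)%N.
  set s := (\sum_(nu < N) Xdot x nu 0%R)%N.
  have s1 : 1 <= 2 ^+ s :> R by rewrite exprn_ege1 // ler1n.
  have ss : s%:R <= 2 ^+ s :> R by rewrite -natrX ler_nat ltnW // ltn_expl.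
  have term i nu : e0 x i nu - p1 i nu - p1 i nu * ln (e0 x i nu / p1 i nu) <=
      (2 * r + 4) * 2 ^+ s.
    have q0 := Dmx_gt0 i nu Dp.
    have q1 : p1 i nu <= 1.
      rewrite mxE invf_le1; last by rewrite mulr_gt0 // addr_gt0.
      by rewrite -[leLHS]mulr1 ler_pM // ?ler1n // lerDr ltW.
    have xs : (Xdot x nu 0)%:R <= s%:R :> R.
      by rewrite ler_nat /s (bigD1 nu) //= leq_addr.
    have xi : (x i nu)%:R <= (Xdot x nu 0)%:R :> R.
      by rewrite ler_nat mxE (bigD1 i) //= leq_addr.
    have e1' : e0 x i nu <= 1.
      rewrite e0E ler_pdivrMr // mul1r -addrA [2^-1 + _]addrC addrA lerD2r.
      by apply: le_trans xi _; rewrite lerDr ltW.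
    have eV : (e0 x i nu)^-1 <= 2 * c (Xdot x) nu.
      rewrite e0E invf_div ler_pdivrMr // -[leLHS]mulr1 [leRHS]mulrAC.
      by rewrite [leLHS]mulrC ler_pM2r // mulrDr mulfV // lerDr mulr_ge0.
    apply: le_trans (loss_term_le (e0_gt0 x i nu) e1' q0 q1) _.
    apply: (@le_trans _ _ (1 + 2 * c (Xdot x) nu)); first by rewrite lerD2l.
    exact: linear_le_scaled r_gt0 xs ss s1.
  apply: (@le_trans _ _ (\sum_(nu < N) \sum_(i < m) ((2 * r + 4) * 2 ^+ s))).
    rewrite /Ltilde big_mkcond; apply: ler_sum => nu _; case: ifP => _.
      by apply: ler_sum => i _.
    apply: sumr_ge0 => i _; rewrite mulr_ge0 ?(le_trans ler01 s1) //.
    by rewrite addr_ge0 // mulr_ge0 // ltW.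
  rewrite !sumr_const !card_ord -mulrnA -[leLHS]mulr_natl natrM.
  by rewrite [leLHS](_ : _ = K * 2 ^+ s) // /K; ring.
apply: (@le_lt_trans _ _ (EE (2 *: p1)%R (fun=> (K * C)%R))%E).
  apply: le_esum => x _; rewrite lee_fin -mulrA -hC mulrA ler_wpM2r //.
  by rewrite ltW // NM_weight_gt0.
rewrite -(integral_sample model (f := fun=> K * C) Dp2) => [|_]; last exact: mulr_ge0.
by rewrite integral_cst // -[X in (_ * X)%E]/(P _ setT) probability_setT mule1 ltry.
Qed.

Lemma est_dominates : dominates P X (@Ltilde R m N n) e1 e0.
Proof.
have finA p : Dmx p -> EE p A \is a fin_num.
  move=> Dp; rewrite ge0_fin_numE; first exact: EA_fin.
  by apply: esum_ge0 => x _; rewrite lee_fin mulr_ge0 // ltW // NM_weight_gt0.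
split=> [p Dp|].
  rewrite !risk_sum //; have := risk_balance Dp => bal.
  (* [E A] is finite, so it may be added to both sides even when the risks are infinite. *)
  by rewrite -(leeD2rE _ _ (finA p Dp)) bal leeD2l // EG_le_EA.
have Dp : Dmx p1 by rewrite -[p1]scale1r; apply: Dp1 => //; rewrite ler1n.
exists p1 => //; rewrite !risk_sum //; have := risk_balance Dp => bal.
(* Here the old risk must be finite as well: an infinite common summand would hide the strict
   inequality. *)
rewrite -(lteD2rE _ _ (finA p1 Dp)) bal lteD2lE ?EG_lt_EA //.
rewrite ge0_fin_numE //; apply: esum_ge0 => x _.
by rewrite lee_fin mulr_ge0 ?Ltilde_ge0 // ltW // NM_weight_gt0.
Qed.

End Domination.

Theorem corollary3p1 (R : realType) (m N : nat) (hm : (1 <= m)%N)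
    (hN : (1 <= N)%N) (r alpha beta : R) (g : R -> R) (n : nat)
    (hr : 0 < r) (halpha : 0 < alpha) (hbeta : 0 <= beta)
    (g_pos : forall t, 0 < t -> 0 < g t)
    (g_bounded : exists M : R, forall t, 0 < t -> `|g t| <= M)
    (g_smooth : smooth_on `]0, +oo[ g)
    (hn : (1 <= n <= N)%N)
    (d : measure_display) (T : measurableType d)
    (P : 'M[R]_(m, N) -> probability T R) (X : T -> 'M[nat]_(m, N))
    (model : NM_model r P X)
    (hint :
      ((m%:R - 1) / 2 < r /\
       (\int[lebesgue_measure]_(t in `[1%R, +oo[)
          (t `^ (alpha - N%:R * m%:R / 2 - 1) * expR (- (beta * t)) * g t)%:E
        < +oo)%E)
      \/
      [/\ r = (m%:R - 1) / 2, N%:R < alpha &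
       (\int[lebesgue_measure]_(t in `[1%R, +oo[)
          (t `^ (alpha - N%:R * m%:R / 2 - 1) * expR (- (beta * t)) * g t)%:E
        < +oo)%E])
    (g_nonincr : forall s t, 0 < s -> s <= t -> g t <= g s)
    (halpha_n : alpha + 1 <= n%:R * (m%:R - 5) / 2) :
  let a0 : R := (1 - m%:R) / 2 in
  let a : 'cV[R]_m := const_mx (1 / 2) in
  dominates P X (@Ltilde R m N n)
    (est r alpha beta g a0 a) (est0 r a0 a).
Proof.
move=> a0 a; apply: est_dominates => //.
by case: hint => [[? _]|[? ? _]]; [left|right].
Qed.
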